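(* Let $c>0$, $T>0$, and let $u$ be the exact solution of the obstacle problem $\min(u_t+cu_x,\,u-g(x))=0$, $u(0,x)=u_0(x)$ on $(0,1)$ with periodic boundary conditions. Let $\ell\ge2$ and $k\ge1$ and assume that $u$ is not shattering on $[0,T]$ with this $\ell$, i.e. there are constants $p,L,c_0$ such that $u(t,\cdot)\in\mathcal C^{\ell+1}_{p,L,c_0}(0,1)$ for all $t\in[0,T]$. Assume the CFL condition $\Delta t\le C_0h$ with $C_0$ small enough (the usual CFL condition for stability of the RKDG scheme). Let $\tilde g$ be either $g_{\Delta t}$ or $x\mapsto\max(g(x),g(x-c\Delta t))$, and let $u_h^n\in V_h$ be defined by $$u_h^0=\Pi_h u_0,\qquad u_h^{n+1}=\Pi_h\big(\max(G^{RK}_{\Delta t}(u_h^n),\tilde g)\big),\quad n\ge 0 .$$ Write $u^n=u(n\Delta t,\cdot)$. Then for both choices of $\tilde g$ there is a constant $C\ge0$ independent of $h,\Delta t,u_h$ such that for all $n\ge 0$ with $n\Delta t\le T$ $$\|u_h^n-u^n\|\le C\Big(h+\frac{h^3}{\Delta t^2}\Big)^{1/2}.$$ In particular, if $\Delta t/h$ is bounded from below ($\Delta t/h\ge\bar C_0$ for some constant $\bar C_0>0$), then $\|u_h^n-u^n\|\le C_1h^{1/2}$ for some constant $C_1$.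
   Context: Periodicity: all functions on $(0,1)$ are identified with their $1$-periodic extensions, and the function classes below are understood for periodic functions. The data $u_0,g$ are Lipschitz continuous. Exact solution: the (viscosity) solution is $u(0,\cdot)=u_0$ and, for $t>0$, $u(t,x)=\max\big(u_0(x-ct),\,g_t(x)\big)$, where $g_t(x):=\max_{\theta\in[0,t]}g(x-c\theta)$. Mesh and space: $I_j=(x_{j-1/2},x_{j+1/2})$, $j=1,\dots,N$, is a partition of $I=(0,1)$, $h_j=|I_j|$, $h=\max_j h_j$, $V_h$ is the space of functions whose restriction to each $I_j$ is a polynomial of degree at most $k$. The meshes are such that the inverse inequalities $\|(\varphi_h)_x\|\le Ch^{-1}\|\varphi_h\|$ (elementwise derivative) and $\|\varphi_h\|_{L^\infty}\le Ch^{-1/2}\|\varphi_h\|$ hold for all $\varphi_h\in V_h$ with $C$ independent of $h$ (quasi-uniform meshes). $\Pi_h$ is the $L^2$ projection onto $V_h$; $(\cdot,\cdot)$ and $\|\cdot\|$ are the $L^2(0,1)$ inner product and norm. $\Delta t>0$ is the time step. Runge-Kutta DG (RKDG) operator: superscripts $\mp$ denote left/right limits at the cell interfaces (with periodic identification of the endpoints). Let $\mathcal H(\phi,\varphi)=\sum_j\mathcal H_j(\phi,\varphi)$ with $$\mathcal H_j(\phi,\varphi)=\int_{I_j}c\,\phi\,\varphi_x\,dx-c\big(\phi^-_{j+1/2}\varphi^-_{j+1/2}-\phi^-_{j-1/2}\varphi^+_{j-1/2}\big).$$ For $v_h\in V_h$, $G^{RK}_{\Delta t}(v_h):=w_h\in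 V_h$ is obtained from $v_h^1,v_h^2\in V_h$ by the TVD-RK3 steps, for all $\varphi_h\in V_h$: $(v_h^1-v_h,\varphi_h)=\Delta t\,\mathcal H(v_h,\varphi_h)$; $\ (v_h^2-\tfrac34v_h-\tfrac14v_h^1,\varphi_h)=\tfrac{\Delta t}{4}\mathcal H(v_h^1,\varphi_h)$; $\ (w_h-\tfrac13v_h-\tfrac23v_h^2,\varphi_h)=\tfrac{2\Delta t}{3}\mathcal H(v_h^2,\varphi_h)$. Function class: $\mathcal C^{\ell+1}_{p,L,c_0}(0,1)$ is the set of $v:(0,1)\to\mathbb R$ that are Lipschitz continuous with $\|v'\|_{L^\infty}\le L$, piecewise $C^{\ell+1}$ with $\|v^{(\ell+1)}\|_{L^\infty}\le c_0$ (the derivative being taken almost everywhere), and have at most $p\ge 0$ non-regular points (points near which $v$ is not $C^{\ell+1}$). *)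

(* Defs.v *)
From mathcomp Require Import all_boot all_order all_algebra.
From mathcomp Require Import all_classical all_reals all_analysis.

Set Implicit Arguments.
Unset Strict Implicit.
Unset Printing Implicit Defensive.

Import Order.TTheory GRing.Theory Num.Theory.
Import numFieldNormedType.Exports.

Local Open Scope classical_set_scope.
Local Open Scope ring_scope.

(* A function on (0,1) is represented by its 1-periodic extension to R. *)

Section FunctionSpaces.
Context {R : realType}.
Implicit Types (f g v phi : R -> R).

Definition ip f g : R :=
  \int[@lebesgue_measure R]_(y in `]0, 1[) (f y * g y).

Definition norm01 (q : \bar R) f : \bar R :=
  Lnorm (@lebesgue_measure R) q (EFin \o (f \_ `]0, 1[)).

Definition normL2 : (R -> R) -> \bar R := norm01 2%:E.
Definition normLoo : (R -> R) -> \bar R := norm01 +oo%E.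

Definition regular_at (m : nat) v (x : R) : Prop :=
  \forall y \near x,
    (forall i, (i < m)%N -> derivable (derive1n i v) y 1) /\
    {for y, continuous (derive1n m v)}.

(* The class of the paper is [piecewise_class l.+1 p L c0]; the non-regular
   points are counted on the circle R/Z, i.e. in [0, 1[.  At points where an
   iterated derivative does not exist, derive1n has an unspecified value; these
   points are negligible for the essential suprema below. *)
Definition piecewise_class (m p : nat) (L c0 : R) v : Prop :=
  [/\ periodic v 1,
      [lipschitz v x | x in setT],
      (normLoo (derive1 v) <= L%:E)%E,
      ([set x | (0 <= x < 1)%R /\ ~ regular_at m v x] #<= `I_p)%card &
      (normLoo (derive1n m v) <= c0%:E)%E].

End FunctionSpaces.

Section ExactSolution.
Context {R : realType}.

(* The supremum is a maximum when g is continuous and 0 <= t. *)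
Definition running_max (c : R) (g : R -> R) (t x : R) : R :=
  sup [set g (x - c * theta) | theta in `[0, t]].

Definition two_point_max (c : R) (g : R -> R) (t x : R) : R := Num.max (g x) (g (x - c * t)).

(* The value at t = 0 is set apart because u0 >= g is not assumed. *)
Definition exact_sol (c : R) (u0 g : R -> R) (t x : R) : R :=
  if t == 0 then u0 x else Num.max (u0 (x - c * t)) (running_max c g t x).

End ExactSolution.

Section Scheme.
Context {R : realType}.

(* The cells are ]x_ j, x_ j.+1[ for j < N; x_ j is x_{j+1/2} in the usual
   half-integer numbering. *)
Definition is_mesh (N : nat) (x_ : nat -> R) : Prop :=
  [/\ x_ 0%N = 0, x_ N = 1 & forall j, (j < N)%N -> x_ j < x_ j.+1].

Definition mesh_size (N : nat) (x_ : nat -> R) : R :=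
  \big[Num.max/0]_(j < N) (x_ j.+1 - x_ j).

(* No condition is put on the values at the nodes. *)
Definition in_Vh (k N : nat) (x_ : nat -> R) (phi : R -> R) : Prop :=
  periodic phi 1 /\
  forall j, (j < N)%N -> exists2 P : {poly R}, (size P <= k.+1)%N &
    forall y, x_ j < y < x_ j.+1 -> phi y = P.[y].

(* For phi in V_h, [derive1 phi] is the elementwise derivative off the nodes. *)
Definition inverse_inequalities (k N : nat) (x_ : nat -> R) (Cinv : R) : Prop :=
  forall phi, in_Vh k N x_ phi ->
    (normL2 (derive1 phi) <= (Cinv / mesh_size N x_)%:E * normL2 phi)%E /\
    (normLoo phi <= (Cinv / Num.sqrt (mesh_size N x_))%:E * normL2 phi)%E.

Definition trace_left (phi : R -> R) (a : R) : R := lim (phi y @[y --> a^'-]).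
Definition trace_right (phi : R -> R) (a : R) : R := lim (phi y @[y --> a^'+]).

(* By periodicity, trace_left phi (x_ 0) = trace_left phi (x_ N). *)
Definition DG_cell_form (c : R) (x_ : nat -> R) (phi psi : R -> R) (j : nat) : R :=
  \int[@lebesgue_measure R]_(y in `]x_ j, x_ j.+1[) (c * phi y * derive1 psi y)
  - c * (trace_left phi (x_ j.+1) * trace_left psi (x_ j.+1)
         - trace_left phi (x_ j) * trace_right psi (x_ j)).

Definition DG_form (c : R) (N : nat) (x_ : nat -> R) (phi psi : R -> R) : R :=
  \sum_(j < N) DG_cell_form c x_ phi psi j.

(* [RKDG_step c k N x_ dt v w] means w = G^RK_dt(v), and [L2_projection k N x_ f w]
   means w = Pi_h f; both determine w up to its values at the nodes. *)
Definition RKDG_step (c : R) (k N : nat) (x_ : nat -> R) (dt : R)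
    (v w : R -> R) : Prop :=
  in_Vh k N x_ w /\
  exists v1 v2 : R -> R,
    [/\ in_Vh k N x_ v1, in_Vh k N x_ v2 &
        forall phi, in_Vh k N x_ phi ->
        [/\ ip (fun y => v1 y - v y) phi = dt * DG_form c N x_ v phi,
            ip (fun y => v2 y - 3 / 4 * v y - 1 / 4 * v1 y) phi
              = dt / 4 * DG_form c N x_ v1 phi &
            ip (fun y => w y - 1 / 3 * v y - 2 / 3 * v2 y) phi
              = 2 * dt / 3 * DG_form c N x_ v2 phi]].

Definition L2_projection (k N : nat) (x_ : nat -> R) (f w : R -> R) : Prop :=
  in_Vh k N x_ w /\
  forall phi, in_Vh k N x_ phi -> ip (fun y => w y - f y) phi = 0.

Definition obstacle_scheme (c : R) (k N : nat) (x_ : nat -> R) (dt : R)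
    (u0 gt : R -> R) (uh : nat -> R -> R) : Prop :=
  L2_projection k N x_ u0 (uh 0%N) /\
  forall n, exists2 w, RKDG_step c k N x_ dt (uh n) w &
    L2_projection k N x_ (fun y => Num.max (w y) (gt y)) (uh n.+1).

End Scheme.

(* Main.v *)
Require Import Defs.
From mathcomp Require Import all_boot all_order all_algebra.
From mathcomp Require Import all_classical all_reals all_analysis.
From mathcomp Require Import measurable_realfun ess_sup_inf ring lra.

Import Order.TTheory GRing.Theory Num.Theory.
Import numFieldNormedType.Exports.

Local Open Scope classical_set_scope.
Local Open Scope ring_scope.

(* Let I v be the continuous piecewise linear interpolant of v at the nodes and
   q its derivative.  The DG form sees I v exactly (H(I v, .) = - c (q, .)), and
   H(q, .) only involves the jumps of q, so the perturbed energy estimate for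
   the third order Runge-Kutta scheme gives
     |G(u_h) - (I v - c dt q)| <= |u_h - I v| + O(h^(3/2))
   as soon as v' has bounded variation, in which case also v - I v and
   v(. - c dt) - (I v - c dt q) are O(h^(3/2)) in L^2.  Taking the maximum with
   the obstacle and projecting are contractions, and u^(n+1) is the maximum of
   u^n(. - c dt) and g_dt, so |u_h^n - I u^n| grows by O(h^(3/2)) per step, that
   is by O(h^(3/2) / dt) in total.  For the two-point obstacle, the extra error
   is O(h^(3/2)) too, except for O(dt) in the first step.  By Landau's inequality
   between the singular points, non-shattering bounds the variation of u_x(t, .)
   uniformly in t. *)

(** * Stability of the Runge-Kutta step *)

(** Taking the maximum is used only through its contraction property, so no cancellation between
    steps enters: the error of the previous step has to reappear with factor 1, and the defects are
    simply added. With at most T / dt steps this gives h^(3/2) / dt, the square root of h^3 / dt^2.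
    The nodal interpolant is the comparison function because it has no jump at the interfaces. The
    gain from h to h^(3/2), in spite of the kinks, comes from a summation: on each cell the error is
    at most h times an oscillation D_j of v'; its square integrates to at most h^3 D_j^2, and the
    sum of D_j^2 is bounded by the maximal D_j times the total variation. The delicate point is
    uniformity in time. Singular points of u(t, .) may come arbitrarily close to each other, so v''
    has no uniform bound. Landau's inequality bounds it by a multiple of the inverse distance of
    consecutive singular points, so each gap contributes a fixed amount to the variation of v',
    however short it is. *)

Section AbstractStability.
Context {R : realType}.
Local Notation U := (R -> R).
Implicit Types (S : U -> Prop).

Definition lin_closed S := forall a x y, S x -> S y -> S (a *: x + y).

(** Linearity is relative to [S]: [ip] and the DG form are defined on all functions, but additivity
    is only available where the integrals and traces are under control. *)
Definition bilinear_on S (b : U -> U -> R) :=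
  (forall a x y z, S x -> S y -> S z -> b (a *: x + y) z = a * b x z + b y z) /\
  (forall a x y z, S x -> S y -> S z -> b z (a *: x + y) = a * b z x + b z y).

Lemma lin_closed0 S x : lin_closed S -> S x -> S 0.
Proof. by move=> cS Sx; have := cS (-1) x x Sx Sx; rewrite scaleN1r addNr. Qed.

Lemma lin_closedZ S a x : lin_closed S -> S x -> S (a *: x).
Proof.
by move=> cS Sx; have := cS a x 0 Sx (lin_closed0 _ _ cS Sx); rewrite addr0.
Qed.

Lemma lin_closedD S x y : lin_closed S -> S x -> S y -> S (x + y).
Proof. by move=> cS Sx Sy; have := cS 1 x y Sx Sy; rewrite scale1r. Qed.

Lemma lin_closedN S x : lin_closed S -> S x -> S (- x).
Proof. by move=> cS Sx; rewrite -scaleN1r; exact: lin_closedZ. Qed.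

(** Cancels one norm after an identity has been tested with its own left member. *)
Lemma le_of_sqr_le (x y : R) : 0 <= y -> x ^+ 2 <= y * x -> x <= y.
Proof. by have [//|xy y0 h] := leP x y; nra. Qed.

Section bilinear_on_theory.
Variables (S : U -> Prop) (b : U -> U -> R).
Hypotheses (cS : lin_closed S) (bb : bilinear_on S b).

Lemma bilinD_l x y z : S x -> S y -> S z -> b (x + y) z = b x z + b y z.
Proof. by move=> ? ? ?; have := bb.1 1 x y z; rewrite scale1r mul1r; apply. Qed.

Lemma bilinD_r x y z : S x -> S y -> S z -> b z (x + y) = b z x + b z y.
Proof. by move=> ? ? ?; have := bb.2 1 x y z; rewrite scale1r mul1r; apply. Qed.

Lemma bilinZ_l a x z : S x -> S z -> b (a *: x) z = a * b x z.
Proof.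
move=> Sx Sz; have S0 := lin_closed0 _ _ cS Sx.
have b0 : b 0 z = 0 by have := bilinD_l _ _ _ S0 S0 Sz; rewrite addr0; lra.
by have := bb.1 a x 0 z Sx S0 Sz; rewrite b0 !addr0.
Qed.

Lemma bilinZ_r a x z : S x -> S z -> b z (a *: x) = a * b z x.
Proof.
move=> Sx Sz; have S0 := lin_closed0 _ _ cS Sx.
have b0 : b z 0 = 0 by have := bilinD_r _ _ _ S0 S0 Sz; rewrite addr0; lra.
by have := bb.2 a x 0 z Sx S0 Sz; rewrite b0 !addr0.
Qed.

Lemma bilinN_l x z : S x -> S z -> b (- x) z = - b x z.
Proof. by move=> ? ?; rewrite -scaleN1r bilinZ_l // mulN1r. Qed.

End bilinear_on_theory.

Variables (S : U -> Prop) (ip B : U -> U -> R).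
Hypotheses (cS : lin_closed S) (bip : bilinear_on S ip) (bB : bilinear_on S B).
Hypothesis ipC : forall x y, S x -> S y -> ip x y = ip y x.
Hypothesis ip_ge0 : forall x, S x -> 0 <= ip x x.
Let nrm x := Num.sqrt (ip x x).
Hypothesis B_le0 : forall x, S x -> B x x <= 0.
Hypothesis B_le : forall x y, S x -> S y -> `|B x y| <= nrm x * nrm y.

Let SZ a x : S x -> S (a *: x). Proof. exact: lin_closedZ. Qed.
Let SD x y : S x -> S y -> S (x + y). Proof. exact: lin_closedD. Qed.
Let SN x : S x -> S (- x). Proof. exact: lin_closedN. Qed.
#[local] Hint Resolve SZ SD SN : core.

Let nrm2 x : S x -> nrm x ^+ 2 = ip x x.
Proof. by move=> Sx; rewrite sqr_sqrtr // ip_ge0. Qed.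

Let nrm_ge0 x : 0 <= nrm x. Proof. exact: sqrtr_ge0. Qed.

(* Tadmor's energy identity: with [x, y] = - B x y - B y x, one has
   |e + b1 + b2/2 + b3/6|^2 = |e|^2 - |b2|^2/12 + |b3|^2/36 + [b2, b2]/36
     - [e + b1/2 + b2/6, same] - [b1 + b2, same]/12
   when r = 0, and |b3| <= |b2|, [b2, b2] <= 2 |b2|^2. *)
Lemma rk3_perturbed_stability e b1 b2 b3 (r : U -> R) (rho : R) :
  S e -> S b1 -> S b2 -> S b3 -> 0 <= rho ->
  (forall f, S f -> ip b1 f = B e f) ->
  (forall f, S f -> ip b2 f = B b1 f + r f) ->
  (forall f, S f -> ip b3 f = B b2 f) ->
  (forall f, S f -> `|r f| <= rho * nrm f) ->
  nrm (e + b1 + (1/2) *: b2 + (1/6) *: b3) <= nrm e + rho.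
Proof.
move=> Se S1 S2 S3 rho0 h1 h2 h3 hr.
have n1 : nrm b1 <= nrm e.
  apply: le_of_sqr_le => //; rewrite nrm2 // h1 //.
  exact: le_trans (ler_norm _) (B_le _ _ Se S1).
have n2 : nrm b2 <= nrm e + rho.
  apply: le_of_sqr_le; first exact: addr_ge0.
  rewrite nrm2 // h2 // mulrDl lerD //.
    apply: le_trans (le_trans (ler_norm _) (B_le _ _ S1 S2)) _.
    by rewrite ler_wpM2r.
  exact: le_trans (ler_norm _) (hr _ S2).
have n3 : nrm b3 <= nrm b2.
  apply: le_of_sqr_le => //; rewrite nrm2 // h3 //.
  exact: le_trans (ler_norm _) (B_le _ _ S2 S3).
(* Since [[b2, b2]] is [- 2 * B b2 b2], this and [r33] balance the energy identity exactly: - 1/12 +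
   1/36 + 2/36 = 0. Hence the need for constant 1 in [B_le]. *)
have B22 : - B b2 b2 <= ip b2 b2.
  by have := B_le _ _ S2 S2; rewrite -expr2 nrm2 // ler_norml => /andP[+ _]; lra.
have r33 : ip b3 b3 <= ip b2 b2.
  by rewrite -!nrm2 //; have := nrm_ge0 b3; have := nrm_ge0 b2; nra.
have Q1 : B (e + (1/2) *: b1 + (1/6) *: b2) (e + (1/2) *: b1 + (1/6) *: b2) <= 0.
  by apply: B_le0; auto 7.
have Q2 : B (b1 + b2) (b1 + b2) <= 0 by apply: B_le0; auto.
rewrite !(bilinD_l _ _ bB, bilinD_r _ _ bB) in Q1; auto 7.
rewrite !(bilinZ_l _ _ cS bB, bilinZ_r _ _ cS bB) in Q1; auto.
rewrite !(bilinD_l _ _ bB, bilinD_r _ _ bB) in Q2; auto 7.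
have re := hr _ Se; have r1 := hr _ S1; have r2 := hr _ S2.
move: re r1 r2; rewrite !ler_norml => /andP[_ re] /andP[_ r1] /andP[_ r2].
(* After expansion, the relations defining [b1], [b2], [b3] leave an inequality that is linear in
   the values of [ip], [B] and [r]. *)
have K : nrm (e + b1 + (1/2) *: b2 + (1/6) *: b3) ^+ 2 <= (nrm e + rho) ^+ 2.
  rewrite nrm2; last by auto 7.
  rewrite !(bilinD_l _ _ bip, bilinD_r _ _ bip); auto 7.
  rewrite !(bilinZ_l _ _ cS bip, bilinZ_r _ _ cS bip); auto.
  have En := nrm2 _ Se.
  rewrite !(ipC e) // (ipC b1 b2) // (ipC b1 b3) // (ipC b2 b3) //.
  have := h1 _ Se; have := h1 _ S1; have := h1 _ S2.
  have := h2 _ Se; have := h2 _ S1; have := h2 _ S2.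
  have := h3 _ Se; have := h3 _ S1; have := h3 _ S2.
  rewrite (ipC b1 b2) //.
  have L1 : rho * nrm b1 <= rho * nrm e by rewrite ler_wpM2l.
  have L2 : rho * nrm b2 <= rho * (nrm e + rho) by rewrite ler_wpM2l.
  have rr : 0 <= rho ^+ 2 by exact: sqr_ge0.
  have -> : (nrm e + rho) ^+ 2 = ip e e + 2 * (rho * nrm e) + rho ^+ 2.
    by rewrite -En; ring.
  have : rho * (nrm e + rho) = rho * nrm e + rho ^+ 2 by ring.
  lra.
by move: K; rewrite ler_pXn2r // nnegrE ?addr_ge0.
Qed.

(** For a linear operator the three stages amount to the Taylor polynomial 1 + z + z^2/2 + z^3/6.
    Applied to the error [v - I], the first increment has no defect because [B I] is exactly
    [- dl * ip q]; the second has the defect [- dl * B q], and the third has none. *)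
Lemma rk3_one_step_stability v v1 v2 w I q (dl rho : R) :
  S v -> S v1 -> S v2 -> S w -> S I -> S q -> 0 <= rho ->
  (forall f, S f -> ip (v1 - v) f = B v f) ->
  (forall f, S f -> ip (v2 - (3/4) *: v - (1/4) *: v1) f = 1/4 * B v1 f) ->
  (forall f, S f -> ip (w - (1/3) *: v - (2/3) *: v2) f = 2/3 * B v2 f) ->
  (forall f, S f -> B I f = - dl * ip q f) ->
  (forall f, S f -> `|dl * B q f| <= rho * nrm f) ->
  nrm (w - (I - dl *: q)) <= nrm (v - I) + rho.
Proof.
move=> Sv S1 S2 Sw SI Sq rho0 h1 h2 h3 hI hq.
pose b1 := v1 - v + dl *: q.
(* The stage residuals are combined so that [b2] represents [B (v1 - v)] and [b3] represents
   [B b2]. *)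
pose b2 := 4 *: v2 - 2 *: v - 2 *: v1.
pose b3 := 6 *: (w - (1/3) *: v - (2/3) *: v2) - 4 *: (v1 - v) - 2 *: b2.
have -> : w - (I - dl *: q) = (v - I) + b1 + (1/2) *: b2 + (1/6) *: b3.
  by apply/funext => y; rewrite /b3 /b2 /b1 !fctE /GRing.scale /=; lra.
have Sb1 : S b1 by rewrite /b1; auto 10.
have Sb2 : S b2 by rewrite /b2; auto 10.
have Sb3 : S b3 by rewrite /b3; auto 10.
have b2E f : S f -> ip b2 f = B v1 f - B v f.
  move=> Sf; have -> : b2 = 4 *: (v2 - (3/4) *: v - (1/4) *: v1) - (v1 - v).
    by apply/funext => y; rewrite /b2 !fctE /GRing.scale /=; lra.
  rewrite (bilinD_l _ _ bip) //; auto 10.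
  rewrite (bilinZ_l _ _ cS bip) //; auto 10.
  rewrite (bilinN_l _ _ cS bip) //; auto 10.
  by rewrite h2 // h1 //; lra.
apply: (rk3_perturbed_stability _ _ _ _ (fun f => - dl * B q f)) => //.
- by auto.
- move=> f Sf; rewrite /b1 (bilinD_l _ _ bip) //; auto.
  rewrite (bilinZ_l _ _ cS bip) // h1 // (bilinD_l _ _ bB) //; auto.
  by rewrite (bilinN_l _ _ cS bB) // hI //; ring.
- move=> f Sf.
  rewrite b2E // /b1 !(bilinD_l _ _ bB) //; auto 10.
  by rewrite (bilinN_l _ _ cS bB) // (bilinZ_l _ _ cS bB) //; lra.
- move=> f Sf.
  rewrite {1}/b3 !(bilinD_l _ _ bip) //; auto 10.
  rewrite !(bilinN_l _ _ cS bip, bilinZ_l _ _ cS bip) //; auto 10.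
  rewrite b2E // h3 // h1 // /b2 !(bilinD_l _ _ bB) //; auto 10.
  by rewrite !(bilinN_l _ _ cS bB, bilinZ_l _ _ cS bB) //; auto 10; lra.
- by move=> f Sf; rewrite mulNr normrN; exact: hq.
Qed.

End AbstractStability.

(** * Bounded measurable functions and the L2 norm *)

Section TameFunctions.
Context {R : realType}.
Notation mu := (@lebesgue_measure R).
Implicit Types (a b M : R) (f g : R -> R).

(** This class consists of integrable functions, is stable under sums, products and maxima, and
    ignores the values at the ends, which are arbitrary for elements of V_h at the nodes. *)
Definition tame a b f :=
  measurable_fun `]a, b[ f /\ exists M, forall x, a < x < b -> `|f x| <= M.

Definition integral_oo a b f : R := \int[mu]_(y in `]a, b[) f y.

Lemma tame_integrable a b f : tame a b f -> mu.-integrable `]a, b[ (EFin \o f).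
Proof.
move=> [mf [M fM]]; apply: measurable_bounded_integrable => //.
  by rewrite /= lebesgue_measure_itv/=; case: ifP => // _; rewrite -EFinD ltry.
exists M; split; first exact: num_real.
by move=> K MK x /=; rewrite in_itv /= => /fM /le_trans; apply; exact: ltW.
Qed.

Lemma tame_cst a b (k : R) : tame a b (cst k).
Proof. by split; [exact: measurable_cst|exists `|k|]. Qed.

Lemma tameD a b f g : tame a b f -> tame a b g -> tame a b (f + g).
Proof.
move=> [mf [M fM]] [mg [K gK]]; split; first exact: measurable_funD.
exists (M + K) => x abx; rewrite (le_trans (ler_normD _ _)) // lerD //.
  exact: fM.
exact: gK.
Qed.

Lemma tameM a b f g : tame a b f -> tame a b g -> tame a b (f * g).
Proof.
move=> [mf [M fM]] [mg [K gK]]; split; first exact: measurable_funM.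
by exists (M * K) => x abx; rewrite !fctE normrM ler_pM ?fM ?gK.
Qed.

Lemma tameZ a b (k : R) f : tame a b f -> tame a b (k *: f).
Proof.
move=> tf; have -> : k *: f = cst k * f by apply/funext => x; rewrite !fctE.
exact: tameM (tame_cst _ _ _) tf.
Qed.

Lemma tameN a b f : tame a b f -> tame a b (- f).
Proof. by rewrite -scaleN1r; exact: tameZ. Qed.

Lemma tameB a b f g : tame a b f -> tame a b g -> tame a b (f - g).
Proof. by move=> tf tg; apply: tameD => //; exact: tameN. Qed.

Lemma tame_max a b f g : tame a b f -> tame a b g ->
  tame a b (fun x => Num.max (f x) (g x)).
Proof.
move=> [mf [M fM]] [mg [K gK]]; split; first exact: measurable_maxr.
exists (Num.max M K) => x abx; rewrite le_max.
by case: (leP (f x) (g x)) => _; rewrite (fM, gK) ?orbT.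
Qed.

Lemma tame_continuous a b f : continuous f -> tame a b f.
Proof.
move=> cf; split.
  by apply: measurable_funTS; exact: continuous_measurable_fun.
have [ab|ba] := leP a b; last first.
  by exists 0 => x /andP[ax xb]; have := lt_trans ax (lt_trans xb ba); rewrite ltxx.
have cf' : {within `[a, b], continuous (fun x => `|f x|)}.
  by apply: continuous_subspaceT => x; apply: cvg_norm; exact: cf.
have [z _ zM] := EVT_max ab cf'.
by exists `|f z| => x /andP[ax xb]; apply: zM; rewrite in_itv /= !ltW.
Qed.

Lemma tame_sub a b a' b' f : a <= a' -> b' <= b -> tame a b f -> tame a' b' f.
Proof.
move=> aa' bb' [mf [M fM]]; split; last first.
  by exists M => x /andP[ax xb]; apply: fM; rewrite (le_lt_trans aa') // (lt_le_trans xb).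
apply: measurable_funS mf => // x /=; rewrite !in_itv /= => /andP[ax xb].
by rewrite (le_lt_trans aa') // (lt_le_trans xb).
Qed.

Lemma tame_eq a b f g : (forall x, a < x < b -> f x = g x) ->
  tame a b f -> tame a b g.
Proof.
move=> fg [mf [M fM]]; split; last by exists M => x abx; rewrite -fg ?fM.
by apply: eq_measurable_fun mf => x; rewrite inE /= in_itv /= => /fg.
Qed.

Let itv_cat a b d : a < b -> b < d ->
  `]a, d[%classic = (`]a, b[ `|` [set b]) `|` `]b, d[%classic :> set R.
Proof.
move=> ab bd; apply/seteqP; split=> x /=; rewrite !in_itv /=.
  move=> /andP[ax xd]; have [xb|bx|->] := ltgtP x b; last by left; right.
    by left; left; rewrite ax.
  by right; rewrite xd.
move=> [[/andP[ax xb]|->]|/andP[bx xd]]; first by rewrite ax (lt_trans xb).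
  by rewrite ab.
by rewrite xd (lt_trans ab).
Qed.

Lemma tame_cat a b d f : a < b -> b < d ->
  tame a b f -> tame b d f -> tame a d f.
Proof.
move=> ab bd [mf [M fM]] [mg [K gK]]; split; last first.
  exists (Num.max `|f b| (Num.max M K)) => x /andP[ax xd]; rewrite !le_max.
  have [xb|bx|->] := ltgtP x b; rewrite ?lexx //.
    by rewrite fM ?orbT // ax xb.
  by rewrite gK ?orbT // bx xd.
rewrite (itv_cat _ _ _ ab bd); apply/measurable_funU => //; first exact: measurableU.
by split => //; apply/measurable_funU => //; split => //; exact: measurable_fun_set1.
Qed.

Lemma integral_oo_cat a b d f : a < b -> b < d ->
  tame a b f -> tame b d f ->
  integral_oo a d f = integral_oo a b f + integral_oo b d f.
Proof.
move=> ab bd tf tg; have := tame_integrable _ _ _ (tame_cat _ _ _ _ ab bd tf tg).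
rewrite /integral_oo (itv_cat _ _ _ ab bd) => it.
have mU : measurable (`]a, b[ `|` [set b] : set R) by exact: measurableU.
rewrite Rintegral_setU //; last first.
  rewrite disj_set2E; apply/eqP/seteqP; split => // x /=.
  by rewrite !in_itv /= => -[[/andP[_ xb]|->] /andP[bx _]]; move: bx; rewrite ?ltxx // ltNge ltW.
rewrite Rintegral_setU //; first by rewrite Rintegral_set1 addr0.
  by apply: integrableS it => //; first exact: measurableU; move=> x; left.
rewrite disj_set2E; apply/eqP/seteqP; split => // x /=.
by rewrite !in_itv /= => -[/andP[_ xb] xE]; move: xb; rewrite xE ltxx.
Qed.

Lemma eq_integral_oo a b f g : (forall x, a < x < b -> f x = g x) ->
  integral_oo a b f = integral_oo a b g.
Proof. by move=> fg; apply: eq_Rintegral => x; rewrite inE /= in_itv /= => /fg. Qed.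

Lemma integral_ooD a b f g : tame a b f -> tame a b g ->
  integral_oo a b (f + g) = integral_oo a b f + integral_oo a b g.
Proof. by move=> tf tg; apply: RintegralD => //; exact: tame_integrable. Qed.

Lemma integral_ooZ a b (k : R) f : tame a b f ->
  integral_oo a b (k *: f) = k * integral_oo a b f.
Proof. by move=> tf; apply: RintegralZl => //; exact: tame_integrable. Qed.

Lemma integral_oo_ge0 a b f : (forall x, a < x < b -> 0 <= f x) ->
  0 <= integral_oo a b f.
Proof. by move=> f0; apply: Rintegral_ge0 => x /=; rewrite in_itv /= => /f0. Qed.

Lemma le_integral_oo a b f g : tame a b f -> tame a b g ->
  (forall x, a < x < b -> f x <= g x) -> integral_oo a b f <= integral_oo a b g.
Proof.
move=> tf tg fg; apply: le_Rintegral => //; try exact: tame_integrable.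
Qed.

Lemma integral_oo_cst a b (k : R) : a < b -> integral_oo a b (cst k) = k * (b - a).
Proof.
move=> ab; rewrite /integral_oo Rintegral_cst //= lebesgue_measure_itv /=.
by rewrite lte_fin ab -EFinD.
Qed.

Lemma integral_oo_deriv_poly a b (P : {poly R}) : a < b ->
  integral_oo a b (horner P^`()) = P.[b] - P.[a].
Proof.
move=> ab; have tP : tame a b (horner P^`()).
  by apply: tame_continuous; exact: continuous_horner.
have cP : {within `[a, b], continuous (horner P^`())}.
  by apply: continuous_subspaceT; exact: continuous_horner.
rewrite /integral_oo Rintegral_itv_bndo_bndc; last exact: tame_integrable.
rewrite Rintegral_itv_obnd_cbnd; last first.
  apply: integrableS (continuous_compact_integrable (@segment_compact _ a b) cP) => //.
  by move=> x /=; rewrite !in_itv /= => /andP[/ltW -> ->].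
rewrite /Rintegral (@continuous_FTC2 _ _ (horner P)) //=.
  split.
  - by move=> x _; exact: derivable_horner.
  - by apply: cvg_at_right_filter; exact: continuous_horner.
  - by apply: cvg_at_left_filter; exact: continuous_horner.
by move=> x _; rewrite derivE.
Qed.

End TameFunctions.

Section L2norm.
Context {R : realType}.
Notation mu := (@lebesgue_measure R).
Implicit Types (f g : R -> R).

Definition nrm f : R := Num.sqrt (ip f f).

Lemma ipE f g : ip f g = integral_oo 0 1 (f * g).
Proof. by []. Qed.

Lemma ipC f g : ip f g = ip g f.
Proof. by apply: eq_integral_oo => x _; rewrite mulrC. Qed.

Lemma tame_lin_closed (a b : R) : lin_closed (tame a b).
Proof. by move=> k f g tf tg; apply: tameD => //; exact: tameZ. Qed.

Lemma ip_bilinear : bilinear_on (tame 0 1) (@ip R).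
Proof.
have L k f g h : tame 0 1 f -> tame 0 1 g -> tame 0 1 h ->
    ip (k *: f + g) h = k * ip f h + ip g h.
  move=> tf tg th; rewrite !ipE.
  transitivity (integral_oo 0 1 (k *: (f * h) + g * h)).
    by apply: eq_integral_oo => x _; rewrite !fctE mulrDl -scalerAl.
  have tfh := tameM _ _ _ _ tf th; have tgh := tameM _ _ _ _ tg th.
  by rewrite integral_ooD ?integral_ooZ //; exact: tameZ.
split=> // k f g h tf tg th.
by rewrite ipC L // ![ip h _]ipC.
Qed.

Lemma ip_ge0 f : 0 <= ip f f.
Proof. by apply: integral_oo_ge0 => x _; exact: sqr_ge0. Qed.

Lemma nrm_ge0 f : 0 <= nrm f. Proof. exact: sqrtr_ge0. Qed.

Lemma nrm2 f : nrm f ^+ 2 = ip f f.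
Proof. by rewrite sqr_sqrtr // ip_ge0. Qed.

(** Common source of the Cauchy-Schwarz inequality for integrals and for finite sums, including
    vectors of norm zero. *)
Lemma quad_ge0_discr (a b d : R) : 0 <= a ->
  (forall t, 0 <= t ^+ 2 * a + 2 * t * b + d) -> b ^+ 2 <= a * d.
Proof.
move=> a0 h; have [a1|a1] := eqVneq a 0; last first.
  have a2 : 0 < a by rewrite lt0r a1.
  have := h (- b / a); rewrite -(pmulr_rge0 _ a2).
  by rewrite (_ : a * (_ + d) = a * d - b ^+ 2) ?subr_ge0 //; field.
rewrite a1 mul0r; have [->|b0] := eqVneq b 0; first by rewrite expr0n.
(* For [a = 0] the quadratic is affine in [t], and here it takes the value -1. *)
have := h (- (d + 1) / (2 * b)); rewrite a1 mulr0 add0r.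
by rewrite (_ : _ + d = -1) ?ler0N1 //; field.
Qed.

Lemma cauchy_schwarz f g : tame 0 1 f -> tame 0 1 g ->
  `|ip f g| <= nrm f * nrm g.
Proof.
move=> tf tg; rewrite -ler_sqr ?nnegrE ?mulr_ge0 ?nrm_ge0 //.
rewrite real_normK ?num_real // exprMn !nrm2.
apply: quad_ge0_discr => [|t]; first exact: ip_ge0.
have [bl br] := ip_bilinear; have tt : tame 0 1 (t *: f + g) by exact: tame_lin_closed.
have := ip_ge0 (t *: f + g); rewrite bl // !br // (ipC g f).
by congr (0 <= _); ring.
Qed.

Lemma nrmD f g : tame 0 1 f -> tame 0 1 g -> nrm (f + g) <= nrm f + nrm g.
Proof.
move=> tf tg; rewrite -ler_sqr ?nnegrE ?addr_ge0 ?nrm_ge0 //.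
have tfg := tameD _ _ _ _ tf tg.
rewrite sqrrD !nrm2 !(bilinD_l _ _ ip_bilinear, bilinD_r _ _ ip_bilinear) // (ipC g f).
have := le_trans (ler_norm _) (cauchy_schwarz f g tf tg); rewrite mulr2n; lra.
Qed.

Lemma nrmZ (k : R) f : tame 0 1 f -> nrm (k *: f) = `|k| * nrm f.
Proof.
move=> tf; have cS := tame_lin_closed 0 1; have tk := tameZ _ _ k _ tf.
rewrite /nrm (bilinZ_l _ _ cS ip_bilinear) // (bilinZ_r _ _ cS ip_bilinear) //.
by rewrite mulrA -expr2 sqrtrM ?sqr_ge0 // sqrtr_sqr.
Qed.

Lemma nrmN f : tame 0 1 f -> nrm (- f) = nrm f.
Proof. by move=> tf; rewrite -scaleN1r nrmZ // normrN1 mul1r. Qed.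

Lemma nrmB f g : tame 0 1 f -> tame 0 1 g -> nrm (f - g) <= nrm f + nrm g.
Proof.
by move=> tf tg; rewrite -(nrmN g) //; apply: nrmD => //; exact: tameN.
Qed.

Lemma le_nrm f g : tame 0 1 f -> tame 0 1 g ->
  (forall x, 0 < x < 1 -> `|f x| <= `|g x|) -> nrm f <= nrm g.
Proof.
move=> tf tg fg; rewrite ler_sqrt ?ip_ge0 //.
apply: le_integral_oo; try exact: tameM.
move=> x /fg h; rewrite -!expr2 -[f x ^+ 2]real_normK ?num_real //.
by rewrite -[g x ^+ 2]real_normK ?num_real // lerXn2r ?nnegrE.
Qed.

Lemma normL2E f : tame 0 1 f -> normL2 f = (nrm f)%:E.
Proof.
move=> tf; rewrite /normL2 /norm01 unlock /=.
have tff := tameM _ _ _ _ tf tf.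
transitivity (((ip f f)%:E `^ 2^-1)%E); last first.
  by rewrite /= powR12_sqrt // ip_ge0.
congr (poweR _ _).
rewrite /ip /Rintegral fineK; last first.
  by apply: integrable_fin_num => //; exact: (tame_integrable _ _ _ tff).
rewrite [RHS]integral_mkcond; apply: eq_integral => x _ /=.
rewrite /patch; case: ifP => _ /=; last by rewrite normr0 powR0.
by rewrite powR_mulrn // real_normK ?num_real // expr2.
Qed.

(** If the bound failed at a point of continuity, it would fail on a whole interval around it, which
    has positive measure. *)
Lemma normLoo_le_at f (M x : R) : (normLoo f <= M%:E)%E -> 0 < x < 1 ->
  {for x, continuous f} -> `|f x| <= M.
Proof.
rewrite /normLoo /norm01 unlock /= => + x01 cf.
have -> : (0 < mu [set: R])%E.
  have m1 : (mu `]0%R, 1%R[ <= mu [set: R])%E by apply: le_measure; rewrite ?inE.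
  rewrite (lt_le_trans _ m1) //= lebesgue_measure_itv /= lte_fin ltr01.
  by rewrite -EFinD lte_fin subr0.
move=> /ess_supP H; rewrite leNgt; apply/negP => Mfx.
have : \forall y \near x, (0 < y < 1) && (M < `|f y|).
  have h1 : \forall y \near x, y \in `]0, 1[ by apply: near_in_itvoo; rewrite in_itv.
  have cfn : `|f y| @[y --> x] --> `|f x| by apply: cvg_norm; exact: cf.
  have h2 := cvgr_gt _ cfn _ Mfx.
  near=> y; have : y \in `]0, 1[ by near: y; exact: h1.
  by rewrite in_itv /= => ->; near: y; exact: h2.
move=> /nbhs_ballP[e /= e0 eB].
case: H => B [mB B0 sub].
have : (mu `](x - e)%R, (x + e)%R[ <= mu B)%E.
  apply: le_measure; rewrite ?inE // => y /=; rewrite in_itv /= => /andP[h1 h2].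
  apply: sub => /=; apply/negP; rewrite -ltNge.
  have : ball x e y by rewrite /ball /= ltr_distlC h1.
  move=> /eB /andP[y01 My]; rewrite patchE ifT /= ?lte_fin //.
  by apply/mem_set; rewrite /= in_itv.
rewrite B0 lebesgue_measure_itv /= lte_fin ltrD2l gtrN // -EFinB lee_fin.
by lra.
Unshelve. all: by end_near. Qed.

End L2norm.

(** * The discontinuous Galerkin form *)

Section PolynomialPieces.
Context {R : realType}.
Implicit Types (a b d : R) (f : R -> R) (P Q : {poly R}).

Definition poly_integral a b P : R := integral_oo a b (horner P).

Lemma tame_horner a b P : tame a b (horner P).
Proof. by apply: tame_continuous; exact: continuous_horner. Qed.

Lemma poly_integralD a b P Q :
  poly_integral a b (P + Q) = poly_integral a b P + poly_integral a b Q.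
Proof.
rewrite /poly_integral -integral_ooD; try exact: tame_horner.
by apply: eq_integral_oo => x _; rewrite hornerD.
Qed.

Lemma poly_integralZ a b (k : R) P :
  poly_integral a b (k *: P) = k * poly_integral a b P.
Proof.
rewrite /poly_integral -integral_ooZ; last exact: tame_horner.
by apply: eq_integral_oo => x _; rewrite hornerZ.
Qed.

Lemma poly_integral_deriv a b P : a < b ->
  poly_integral a b P^`() = P.[b] - P.[a].
Proof. exact: integral_oo_deriv_poly. Qed.

Lemma trace_left_poly f a d P : d < a ->
  (forall y, d < y < a -> f y = P.[y]) -> trace_left f a = P.[a].
Proof.
move=> da fP; apply/cvg_lim => //.
apply: cvg_trans (_ : horner P y @[y --> a^'-] --> P.[a]); last first.
  by apply: cvg_at_left_filter; exact: continuous_horner.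
apply: near_eq_cvg; near=> y; apply/esym/fP/andP; split; near: y.
  exact: nbhs_left_gt.
exact: nbhs_left_lt.
Unshelve. all: by end_near. Qed.

Lemma trace_right_poly f a b P : a < b ->
  (forall y, a < y < b -> f y = P.[y]) -> trace_right f a = P.[a].
Proof.
move=> ab fP; apply/cvg_lim => //.
apply: cvg_trans (_ : horner P y @[y --> a^'+] --> P.[a]); last first.
  by apply: cvg_at_right_filter; exact: continuous_horner.
apply: near_eq_cvg; near=> y; apply/esym/fP/andP; split; near: y.
  exact: nbhs_right_gt.
exact: nbhs_right_lt.
Unshelve. all: by end_near. Qed.

Lemma derive1_poly f a b P x : a < x < b ->
  (forall y, a < y < b -> f y = P.[y]) -> derive1 f x = P^`().[x].
Proof.
move=> axb fP; rewrite derivE !derive1E; apply: near_eq_derive.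
have : \forall y \near x, y \in `]a, b[ by apply: near_in_itvoo; rewrite in_itv.
by apply: filterS => y; rewrite in_itv /= => /fP.
Qed.

End PolynomialPieces.

(** * Piecewise polynomials on a periodic mesh *)

Section Mesh.
Context {R : realType}.
Variables (N : nat) (x_ : nat -> R).
Hypothesis hm : is_mesh N x_.
Implicit Types (f v phi psi : R -> R) (P V : nat -> {poly R}).
Local Notation h := (mesh_size N x_).

Lemma mesh_N_gt0 : (0 < N)%N.
Proof.
case: hm => x0 x1 _; rewrite lt0n; apply/eqP => N0.
by move: x1; rewrite N0 x0 => /eqP; rewrite eq_sym oner_eq0.
Qed.

Lemma mesh_step j : (j < N)%N -> x_ j < x_ j.+1.
Proof. by case: hm => _ _; apply. Qed.

Lemma mesh_lt i j : (i < j)%N -> (j <= N)%N -> x_ i < x_ j.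
Proof.
elim: j => // j IH; rewrite ltnS leq_eqVlt => /orP[/eqP -> jN|ij jN].
  exact: mesh_step.
by apply: lt_trans (IH ij (ltnW jN)) _; exact: mesh_step.
Qed.

Lemma mesh_le i j : (i <= j)%N -> (j <= N)%N -> x_ i <= x_ j.
Proof. by rewrite leq_eqVlt => /orP[/eqP -> //|ij jN]; exact/ltW/mesh_lt. Qed.

Lemma mesh_ge0 j : (j <= N)%N -> 0 <= x_ j.
Proof. by move=> jN; case: hm => <- _ _; exact: mesh_le. Qed.

Lemma mesh_le1 j : (j <= N)%N -> x_ j <= 1.
Proof. by move=> jN; case: hm => _ <- _; exact: mesh_le. Qed.

Lemma mesh_cell_le j : (j < N)%N -> x_ j.+1 - x_ j <= h.
Proof.
move=> jN; rewrite /mesh_size.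
exact: (le_bigmax 0 (fun i : 'I_N => x_ i.+1 - x_ i) (Ordinal jN)).
Qed.

Lemma mesh_size_gt0 : 0 < h.
Proof.
apply: lt_le_trans (mesh_cell_le _ mesh_N_gt0).
by rewrite subr_gt0; apply: mesh_step; exact: mesh_N_gt0.
Qed.

Lemma mesh_size_le1 : h <= 1.
Proof.
apply/bigmax_leP; split => // i _.
have := mesh_le1 _ (ltn_ord i); have := mesh_ge0 _ (ltnW (ltn_ord i)); lra.
Qed.

Lemma tame_mesh_prefix f n : (n < N)%N ->
  (forall j, (j <= n)%N -> tame (x_ j) (x_ j.+1) f) ->
  tame 0 (x_ n.+1) f /\
  integral_oo 0 (x_ n.+1) f = \sum_(j < n.+1) integral_oo (x_ j) (x_ j.+1) f.
Proof.
have x0 : x_ 0%N = 0 by case: hm.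
elim: n => [|n IH] nN H.
  by rewrite big_ord_recr big_ord0 /= add0r -x0; split => //; exact: H.
have [t1 i1] := IH (ltnW nN) (fun j jn => H j (leqW jn)).
have t2 := H _ (leqnn _); have s2 := mesh_step _ nN.
have s1 : 0 < x_ n.+1 by rewrite -x0; apply: mesh_lt => //; exact: ltnW.
split; first exact: (tame_cat _ _ _ _ s1 s2 t1 t2).
by rewrite big_ord_recr /= -i1; exact: integral_oo_cat.
Qed.

Lemma tame_mesh f : (forall j, (j < N)%N -> tame (x_ j) (x_ j.+1) f) ->
  tame 0 1 f.
Proof.
have := mesh_N_gt0; have xN : x_ N = 1 by case: hm.
case EN : N => [//|M] _ H; rewrite -xN EN.
by apply: (tame_mesh_prefix f M _ _).1; [rewrite EN|move=> j; rewrite -ltnS; exact: H].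
Qed.

Lemma tame_cell f j : (j < N)%N -> tame 0 1 f -> tame (x_ j) (x_ j.+1) f.
Proof. by move=> jN; apply: tame_sub; [exact/mesh_ge0/ltnW|exact: mesh_le1]. Qed.

Lemma integral_mesh f : tame 0 1 f ->
  integral_oo 0 1 f = \sum_(j < N) integral_oo (x_ j) (x_ j.+1) f.
Proof.
move=> tf; have xN : x_ N = 1 by case: hm.
have [M EN] : exists M, N = M.+1 by exists N.-1; rewrite prednK // mesh_N_gt0.
have [|j jM|_] := tame_mesh_prefix f M; first by rewrite EN.
  by apply: tame_cell => //; rewrite EN ltnS.
by rewrite -EN xN.
Qed.

(** Fixing all pieces at once turns integrals and traces into polynomial expressions indexed by the
    cells; the degree bound is kept apart. *)
Definition piecewise_rep phi P := periodic phi 1 /\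
  forall j, (j < N)%N -> forall y, x_ j < y < x_ j.+1 -> phi y = (P j).[y].

Lemma rep_eq phi P j y : piecewise_rep phi P -> (j < N)%N ->
  x_ j < y < x_ j.+1 -> phi y = (P j).[y].
Proof. by move=> [_ hP] jN; exact: hP. Qed.

Lemma in_Vh_rep k phi : in_Vh k N x_ phi ->
  exists2 P, piecewise_rep phi P & forall j, (j < N)%N -> (size (P j) <= k.+1)%N.
Proof.
move=> [pphi H].
have H' j : exists P : {poly R}, (j < N)%N -> (size P <= k.+1)%N /\
    forall y, x_ j < y < x_ j.+1 -> phi y = P.[y].
  case: (ltnP j N) => jN; last by exists 0.
  by have [P sP hP] := H j jN; exists P.
have [P hP] := choice H'.
by exists P; [split => // j jN|move=> j jN]; have [] := hP j jN.
Qed.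

Lemma rep_in_Vh k phi P : piecewise_rep phi P ->
  (forall j, (j < N)%N -> (size (P j) <= k.+1)%N) -> in_Vh k N x_ phi.
Proof. by move=> [pphi hP] sP; split => // j jN; exists (P j); auto. Qed.

Lemma tame_rep phi P : piecewise_rep phi P -> tame 0 1 phi.
Proof.
move=> [_ hP]; apply: tame_mesh => j jN.
apply: (tame_eq _ _ (horner (P j))); last exact: tame_horner.
by move=> y yj; rewrite (hP _ jN).
Qed.

Lemma tame_Vh k phi : in_Vh k N x_ phi -> tame 0 1 phi.
Proof. by move=> /in_Vh_rep[P rP _]; exact: tame_rep rP. Qed.

Lemma derive1_rep phi P j y : piecewise_rep phi P -> (j < N)%N ->
  x_ j < y < x_ j.+1 -> derive1 phi y = (P j)^`().[y].
Proof. by move=> [_ hP] jN yj; apply: (derive1_poly _ _ _ _ _ yj); exact: hP. Qed.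

Lemma tame_derive1_rep phi P : piecewise_rep phi P -> tame 0 1 (derive1 phi).
Proof.
move=> rP; apply: tame_mesh => j jN.
apply: (tame_eq _ _ (horner (P j)^`())); last exact: tame_horner.
by move=> y yj; rewrite (derive1_rep _ _ _ _ rP jN yj).
Qed.

Lemma repZD a v V phi P : piecewise_rep v V -> piecewise_rep phi P ->
  piecewise_rep (a *: v + phi) (fun j => a *: V j + P j).
Proof.
move=> [pv hV] [pp hP]; split=> [y|j jN y yj]; first by rewrite !fctE pv pp.
by rewrite !fctE hornerD hornerZ (hV j) // (hP j).
Qed.

Lemma Vh_lin_closed k : lin_closed (in_Vh k N x_).
Proof.
move=> a v phi /in_Vh_rep[V rV sV] /in_Vh_rep[P rP sP].
apply: (rep_in_Vh _ _ _ (repZD a _ _ _ _ rV rP)) => j jN.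
rewrite (leq_trans (size_polyD _ _)) // geq_max sP // andbT.
by rewrite (leq_trans (size_scale_leq _ _)) // sV.
Qed.

Lemma ip_rep v V phi P : piecewise_rep v V -> piecewise_rep phi P ->
  ip v phi = \sum_(j < N) poly_integral (x_ j) (x_ j.+1) (V j * P j).
Proof.
move=> rV rP; rewrite ipE integral_mesh; last first.
  by apply: tameM; [exact: tame_rep rV|exact: tame_rep rP].
apply: eq_bigr => j _; apply: eq_integral_oo => y yj.
by rewrite hornerM fctE (rep_eq _ _ j _ rV) // (rep_eq _ _ j _ rP).
Qed.

Definition prev_cell j := if j is i.+1 then i else N.-1.

Lemma prev_cell_lt j : (j < N)%N -> (prev_cell j < N)%N.
Proof. by case: j => [|j] /=; [rewrite ltn_predL|exact: ltnW]. Qed.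

Lemma sum_prev_cell (F : nat -> R) :
  \sum_(j < N) F (prev_cell j) = \sum_(j < N) F j.
Proof.
rewrite /prev_cell; case EN : N mesh_N_gt0 => [//|M] _.
by rewrite big_ord_recl big_ord_recr /= addrC.
Qed.

(** The upwind trace at [x_ j], read in the cell to its left, cyclically. *)
Definition inflow V j : R := (V (prev_cell j)).[x_ (prev_cell j).+1].

Lemma trace_left_inflow v V j : (j < N)%N -> piecewise_rep v V ->
  trace_left v (x_ j) = inflow V j.
Proof.
move=> jN rV; rewrite /inflow; case: j jN => [|j] jN /=; last first.
  apply: (trace_left_poly _ _ _ _ (mesh_step _ (ltnW jN))).
  by move=> y; exact: (rep_eq _ _ _ _ rV (ltnW jN)).
have N1 : (N.-1 < N)%N by rewrite ltn_predL.
have sN := mesh_step _ N1; rewrite (ltn_predK jN) in sN *.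
have [x0 xN _] := hm; rewrite x0 xN.
(* To the left of 0 the function is the last piece translated by one period. *)
have -> : (V N.-1).[1] = (V N.-1 \Po ('X + 1%:P)).[0].
  by rewrite horner_comp !hornerE.
apply: (trace_left_poly _ _ (x_ N.-1 - 1)); first by rewrite subr_lt0 -xN.
move=> y /andP[y1 y2]; rewrite horner_comp !hornerE -(proj1 rV y) (rep_eq _ _ N.-1 _ rV) //.
by rewrite (ltn_predK jN) xN; apply/andP; split; lra.
Qed.

Definition DG_poly (c : R) V P : R := \sum_(j < N) c *
  (poly_integral (x_ j) (x_ j.+1) (V j * (P j)^`())
   - (V j).[x_ j.+1] * (P j).[x_ j.+1] + inflow V j * (P j).[x_ j]).

Lemma DG_form_rep c v V phi P : piecewise_rep v V -> piecewise_rep phi P ->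
  DG_form c N x_ v phi = DG_poly c V P.
Proof.
move=> rV rP; apply: eq_bigr => -[j jN] _ /=; rewrite /DG_cell_form.
have s := mesh_step _ jN.
rewrite (trace_left_poly _ _ _ _ s (fun y => rep_eq _ _ _ y rV jN)).
rewrite (trace_left_poly _ _ _ _ s (fun y => rep_eq _ _ _ y rP jN)).
rewrite (trace_right_poly _ _ _ _ s (fun y => rep_eq _ _ _ y rP jN)).
rewrite (trace_left_inflow _ _ _ jN rV).
have -> : \int[lebesgue_measure]_(y in `]x_ j, x_ j.+1[) (c * v y * derive1 phi y)
    = c * poly_integral (x_ j) (x_ j.+1) (V j * (P j)^`()).
  rewrite -poly_integralZ; apply: eq_integral_oo => y yj.
  by rewrite hornerZ hornerM (derive1_rep _ _ _ _ rP jN yj) (rep_eq _ _ _ _ rV jN yj) mulrA.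
ring.
Qed.

Lemma DG_bilinear c k : bilinear_on (in_Vh k N x_) (DG_form c N x_).
Proof.
split=> a v w phi /in_Vh_rep[V rV _] /in_Vh_rep[W rW _] /in_Vh_rep[P rP _].
  rewrite (DG_form_rep _ _ _ _ _ (repZD a _ _ _ _ rV rW) rP).
  rewrite (DG_form_rep _ _ _ _ _ rV rP) (DG_form_rep _ _ _ _ _ rW rP).
  rewrite mulr_sumr -big_split; apply: eq_bigr => j _ /=.
  rewrite /inflow !(hornerD, hornerZ) [(_ + _) * _]mulrDl -scalerAl.
  by rewrite poly_integralD poly_integralZ; ring.
rewrite (DG_form_rep _ _ _ _ _ rP (repZD a _ _ _ _ rV rW)).
rewrite (DG_form_rep _ _ _ _ _ rP rV) (DG_form_rep _ _ _ _ _ rP rW).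
rewrite mulr_sumr -big_split; apply: eq_bigr => j _ /=.
rewrite !(hornerD, hornerZ) derivD derivZ [P j * (_ + _)]mulrDr -scalerAr.
by rewrite poly_integralD poly_integralZ; ring.
Qed.

(** Upwind dissipation: the form equals - c/2 times the sum of the squared jumps. The integral of v
    v_x is a half difference of squares, and the remaining outflow and inflow squares cancel after a
    cyclic shift of the index. *)
Lemma DG_form_le0 c k v : 0 <= c -> in_Vh k N x_ v -> DG_form c N x_ v v <= 0.
Proof.
move=> c0 /in_Vh_rep[V rV _]; rewrite (DG_form_rep _ _ _ _ _ rV rV).
have -> : DG_poly c V V = - (c / 2) *
    \sum_(j < N) ((V j).[x_ j] - inflow V j) ^+ 2.
  transitivity (\sum_(j < N) (- (c/2)) * (((V j).[x_ j] - inflow V j) ^+ 2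
      + ((V j).[x_ j.+1] ^+ 2 - inflow V j ^+ 2))).
    apply: eq_bigr => -[j jN] _ /=.
    have E := poly_integral_deriv _ _ (V j * V j) (mesh_step _ jN).
    rewrite derivM mulrC poly_integralD !hornerM in E.
    have -> : poly_integral (x_ j) (x_ j.+1) (V j * (V j)^`()) =
      ((V j).[x_ j.+1] ^+ 2 - (V j).[x_ j] ^+ 2) / 2 by rewrite !expr2; lra.
    by field.
  rewrite -mulr_sumr big_split /=; congr (_ * _).
  rewrite sumrB (sum_prev_cell (fun j => (V j).[x_ j.+1] ^+ 2)) subrr addr0 //.
rewrite mulNr oppr_le0 mulr_ge0 ?divr_ge0 // sumr_ge0 // => j _.
exact: sqr_ge0.
Qed.

End Mesh.

Section Helpers.
Context {R : realType}.

Lemma sum_cauchy_schwarz n (A B : nat -> R) :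
  `|\sum_(j < n) A j * B j| <=
  Num.sqrt (\sum_(j < n) A j ^+ 2) * Num.sqrt (\sum_(j < n) B j ^+ 2).
Proof.
have s0 (F : nat -> R) : 0 <= \sum_(j < n) F j ^+ 2.
  by apply: sumr_ge0 => j _; exact: sqr_ge0.
rewrite -ler_sqr ?nnegrE ?mulr_ge0 ?sqrtr_ge0 //.
rewrite real_normK ?num_real // exprMn !sqr_sqrtr //.
apply: quad_ge0_discr => // t.
rewrite (_ : _ + _ = \sum_(j < n) (t * A j + B j) ^+ 2).
  exact: (s0 (fun j => t * A j + B j)).
rewrite !mulr_sumr -!big_split /=; apply: eq_bigr => j _; ring.
Qed.

(** Carries a bound that an essential supremum gives inside a cell over to the traces at its
    ends. *)
Lemma poly_le_closed (P : {poly R}) (a b M y : R) : a < b ->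
  (forall z, a < z < b -> P.[z] <= M) -> a <= y <= b -> P.[y] <= M.
Proof.
move=> ab PM /andP[]; rewrite le_eqVlt => /predU1P[<- _|ay].
  rewrite leNgt; apply/negP => lt.
  have cv : horner P z @[z --> a^'+] --> P.[a].
    by apply: cvg_at_right_filter; exact: continuous_horner.
  have : \forall z \near a^'+, M < P.[z] /\ a < z < b.
    near=> z; split; first by near: z; exact: (cvgr_gt _ cv).
    by apply/andP; split; near: z; [exact: nbhs_right_gt|exact: nbhs_right_lt].
  by case/filter_ex => z [+ /PM]; rewrite ltNge => /negP.
rewrite le_eqVlt => /predU1P[->|yb]; last by apply: PM; rewrite ay.
rewrite leNgt; apply/negP => lt.
have cv : horner P z @[z --> b^'-] --> P.[b].
  by apply: cvg_at_left_filter; exact: continuous_horner.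
have : \forall z \near b^'-, M < P.[z] /\ a < z < b.
  near=> z; split; first by near: z; exact: (cvgr_gt _ cv).
  by apply/andP; split; near: z; [exact: nbhs_left_gt|exact: nbhs_left_lt].
by case/filter_ex => z [+ /PM]; rewrite ltNge => /negP.
Unshelve. all: by end_near. Qed.

End Helpers.

(** * Consequences of the inverse inequalities, and the nodal interpolant *)

Section Bounds.
Context {R : realType}.
Variables (N : nat) (x_ : nat -> R).
Hypothesis hm : is_mesh N x_.
Implicit Types (f v phi psi : R -> R) (P V : nat -> {poly R}).
Local Notation h := (mesh_size N x_).

Definition of_pieces P (y : R) : R :=
  let z := y - (Num.floor y)%:~R in
  \sum_(j < N) if x_ j < z < x_ j.+1 then (P j).[z] else 0.

Lemma of_pieces_rep P : piecewise_rep N x_ (of_pieces P) P.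
Proof.
split=> [y|j jN y /andP[y1 y2]].
  rewrite /of_pieces; have -> : y + 1 - (Num.floor (y + 1))%:~R = y - (Num.floor y)%:~R :> R.
    by rewrite (floorDrz y (rpred1 _)) floor1 intrD; lra.
  by [].
have y01 : 0 < y < 1.
  rewrite (le_lt_trans (mesh_ge0 _ _ hm _ (ltnW jN)) y1).
  exact: lt_le_trans y2 (mesh_le1 _ _ hm _ jN).
rewrite /of_pieces (_ : Num.floor y = 0); last first.
  by apply/floor_def; case/andP: y01 => /ltW -> /=; rewrite add0r.
rewrite subr0 (bigD1 (Ordinal jN)) //= y1 y2 /= big1 ?addr0 //.
move=> [i iN] /=; rewrite -val_eqE /= => ij; rewrite ifF //; apply/negP => /andP[i1 i2].
case: (ltngtP i j) ij => // ij _.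
  by have := mesh_le _ _ hm _ _ ij (ltnW jN); lra.
by have := mesh_le _ _ hm _ _ ij (ltnW iN); lra.
Qed.

Variables (k : nat) (Ci : R).
Hypothesis hinv : inverse_inequalities k N x_ Ci.

(** The global inverse inequality is localized by applying it to the element of V_h that agrees with
    [phi] on one cell and vanishes on the others. *)
Lemma trace_inequality phi P j y : piecewise_rep N x_ phi P ->
  (forall j, (j < N)%N -> (size (P j) <= k.+1)%N) -> (j < N)%N ->
  x_ j <= y <= x_ j.+1 ->
  (P j).[y] ^+ 2 <= Ci ^+ 2 / h * poly_integral (x_ j) (x_ j.+1) (P j * P j).
Proof.
move=> rP sP jN yj; have s := mesh_step _ _ hm _ jN.
pose Q i := if i == j then P j else 0.
have rQ := of_pieces_rep Q; set psi := of_pieces Q in rQ.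
have Vpsi : in_Vh k N x_ psi.
  apply: (rep_in_Vh _ _ _ _ _ rQ) => i iN; rewrite /Q.
  by case: eqP => // _; [exact: sP|rewrite size_poly0].
have h0 := mesh_size_gt0 _ _ hm.
have [_] := hinv _ Vpsi; rewrite normL2E; last exact: tame_Vh Vpsi.
rewrite -EFinM => Loo.
rewrite expr2 -hornerM; apply: (poly_le_closed _ _ _ _ _ s _ yj) => z zj.
have z01 : 0 < z < 1.
  case/andP: zj => z1 z2.
  rewrite (le_lt_trans (mesh_ge0 _ _ hm _ (ltnW jN)) z1).
  exact: lt_le_trans z2 (mesh_le1 _ _ hm _ jN).
have psiE t : x_ j < t < x_ j.+1 -> psi t = (P j).[t].
  by move=> tj; rewrite (rep_eq _ _ _ _ _ _ rQ jN tj) /Q eqxx.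
have cz : {for z, continuous psi}.
  apply: cvg_trans (_ : horner (P j) t @[t --> z] --> psi z); last first.
    by rewrite psiE //; exact: continuous_horner.
  apply: near_eq_cvg.
  have : \forall t \near z, t \in `](x_ j), (x_ j.+1)[ by apply: near_in_itvoo; rewrite in_itv.
  by apply: filterS => t; rewrite in_itv /= => /psiE.
have := normLoo_le_at _ _ _ Loo z01 cz; rewrite psiE // => le1.
have {le1} : `|(P j).[z]| ^+ 2 <= (Ci / Num.sqrt h * nrm psi) ^+ 2.
  by rewrite lerXn2r ?nnegrE // (le_trans _ le1).
rewrite real_normK ?num_real // hornerM -expr2 => /le_trans; apply.
rewrite !exprMn exprVn (sqr_sqrtr (ltW h0)) nrm2 (ip_rep _ _ hm _ _ _ _ rQ rQ).
rewrite (bigD1 (Ordinal jN)) //= big1 ?addr0; first by rewrite /Q eqxx.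
move=> [i iN] /=; rewrite -val_eqE /= => /negbTE ij; rewrite /Q ij mul0r.
by rewrite -(scale0r (0 : {poly R})) poly_integralZ mul0r.
Qed.

(** This is the trace inequality for the constant 1: the inverse inequalities by themselves force
    quasi-uniformity. *)
Lemma mesh_quasi_uniform j : (j < N)%N -> h <= Ci ^+ 2 * (x_ j.+1 - x_ j).
Proof.
move=> jN; have s := mesh_step _ _ hm _ jN; have h0 := mesh_size_gt0 _ _ hm.
pose Q (i : nat) := 1 : {poly R}.
have := trace_inequality _ Q j (x_ j) (of_pieces_rep Q) _ jN.
rewrite lexx ltW // => /(_ _ isT); rewrite /Q mulr1 hornerC expr1n.
have -> : poly_integral (x_ j) (x_ j.+1) 1 = x_ j.+1 - x_ j.
  rewrite -[RHS]mul1r -integral_oo_cst //; apply: eq_integral_oo => y _.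
  by rewrite hornerC.
rewrite mulrAC ler_pdivlMr // mul1r; by apply => i _; rewrite size_poly1.
Qed.

Lemma trace_sum phi P (y : nat -> R) : piecewise_rep N x_ phi P ->
  (forall j, (j < N)%N -> (size (P j) <= k.+1)%N) ->
  (forall j, (j < N)%N -> x_ j <= y j <= x_ j.+1) ->
  Num.sqrt (\sum_(j < N) (P j).[y j] ^+ 2) <= `|Ci| / Num.sqrt h * nrm phi.
Proof.
move=> rP sP yP; have h0 := mesh_size_gt0 _ _ hm.
rewrite -ler_sqr ?nnegrE ?sqrtr_ge0 ?mulr_ge0 ?nrm_ge0 ?invr_ge0 ?sqrtr_ge0 //.
rewrite sqr_sqrtr; last by apply: sumr_ge0 => j _; exact: sqr_ge0.
rewrite !exprMn exprVn (sqr_sqrtr (ltW h0)) real_normK ?num_real // nrm2.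
rewrite (ip_rep _ _ hm _ _ _ _ rP rP) mulr_sumr ler_sum // => -[j jN] _ /=.
exact: (trace_inequality _ _ _ _ rP sP jN (yP _ jN)).
Qed.

Lemma DG_form_split c v V phi P : piecewise_rep N x_ v V ->
  piecewise_rep N x_ phi P ->
  DG_form c N x_ v phi = c * (ip v (derive1 phi)
   - \sum_(j < N) (V j).[x_ j.+1] * (P j).[x_ j.+1]
   + \sum_(j < N) inflow N x_ V j * (P j).[x_ j]).
Proof.
move=> rV rP; rewrite (DG_form_rep _ _ hm _ _ _ _ _ rV rP) /DG_poly -mulr_sumr.
congr (c * _); rewrite big_split sumrB /=; congr (_ - _ + _).
rewrite ipE (integral_mesh _ _ hm).
  apply: eq_bigr => -[j jN] _ /=; apply: eq_integral_oo => y yj.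
  by rewrite hornerM fctE (rep_eq _ _ _ _ _ _ rV jN yj) (derive1_rep _ _ _ _ _ _ rP jN yj).
by apply: tameM; [exact: (tame_rep _ _ hm _ _ rV)|exact: (tame_derive1_rep _ _ hm _ _ rP)].
Qed.

(** The volume term costs [|Ci| / h] by the derivative bound, and each of the two interface sums
    [Ci ^+ 2 / h] by the trace inequality. *)
Lemma DG_form_bound c v phi : 0 <= c -> in_Vh k N x_ v -> in_Vh k N x_ phi ->
  `|DG_form c N x_ v phi| <= c * (`|Ci| + 2 * Ci ^+ 2) / h * (nrm v * nrm phi).
Proof.
move=> c0 Vv Vphi; have h0 := mesh_size_gt0 _ _ hm.
have [V rV sV] := in_Vh_rep _ _ _ _ Vv; have [P rP sP] := in_Vh_rep _ _ _ _ Vphi.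
have tv := tame_rep _ _ hm _ _ rV; have tp := tame_rep _ _ hm _ _ rP.
have tdp := tame_derive1_rep _ _ hm _ _ rP.
rewrite (DG_form_split _ _ _ _ _ rV rP) normrM ger0_norm // -!mulrA ler_wpM2l //.
have E1 : `|ip v (derive1 phi)| <= `|Ci| / h * (nrm v * nrm phi).
  apply: le_trans (cauchy_schwarz _ _ tv tdp) _.
  rewrite mulrCA ler_wpM2l ?nrm_ge0 //.
  have [+ _] := hinv _ Vphi; rewrite !normL2E // -EFinM lee_fin => /le_trans; apply.
  by rewrite ler_wpM2r ?nrm_ge0 // ler_wpM2r ?invr_ge0 ?(ltW h0) ?ler_norm.
have CE (a b : R) : `|Ci| / Num.sqrt h * a * (`|Ci| / Num.sqrt h * b) = Ci ^+ 2 / h * (a * b).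
  rewrite -[Ci ^+ 2]real_normK ?num_real // -{3}(sqr_sqrtr (ltW h0)).
  by field; rewrite gt_eqF // sqrtr_gt0.
have y1 j : (j < N)%N -> x_ j <= x_ j.+1 <= x_ j.+1 by move=> /(mesh_step _ _ hm)/ltW ->/=.
have y0 j : (j < N)%N -> x_ j <= x_ j <= x_ j.+1 by move=> /(mesh_step _ _ hm)/ltW ->; rewrite lexx.
have TV := trace_sum _ _ (fun j => x_ j.+1) rV sV y1.
have TP1 := trace_sum _ _ (fun j => x_ j.+1) rP sP y1.
have TP0 := trace_sum _ _ x_ rP sP y0.
have E2 : `|\sum_(j < N) (V j).[x_ j.+1] * (P j).[x_ j.+1]| <= Ci ^+ 2 / h * (nrm v * nrm phi).
  apply: le_trans (sum_cauchy_schwarz N (fun j => (V j).[x_ j.+1]) (fun j => (P j).[x_ j.+1])) _.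
  by rewrite -CE ler_pM ?sqrtr_ge0.
have E3 : `|\sum_(j < N) inflow N x_ V j * (P j).[x_ j]| <= Ci ^+ 2 / h * (nrm v * nrm phi).
  apply: le_trans (sum_cauchy_schwarz N (inflow N x_ V) (fun j => (P j).[x_ j])) _.
  rewrite -CE ler_pM ?sqrtr_ge0 // /inflow.
  by rewrite (sum_prev_cell _ _ hm (fun j => (V j).[x_ j.+1] ^+ 2)).
have -> : (`|Ci| + 2 * Ci ^+ 2) * (h^-1 * (nrm v * nrm phi)) =
  `|Ci| / h * (nrm v * nrm phi) + Ci ^+ 2 / h * (nrm v * nrm phi)
    + Ci ^+ 2 / h * (nrm v * nrm phi) by ring.
apply: le_trans (ler_normD _ _) _; rewrite lerD //.
by apply: le_trans (ler_normB _ _) _; rewrite lerD.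
Qed.

Definition cell_slope v j : R := (v (x_ j.+1) - v (x_ j)) / (x_ j.+1 - x_ j).

(** Its value at the nodes themselves is 0, by [of_pieces]; only its one-sided traces are those of
    the continuous interpolant. *)
Definition lin_interp v : R -> R := of_pieces (fun j =>
  (v (x_ j))%:P + cell_slope v j *: ('X - (x_ j)%:P)).

Definition slope_fun v : R -> R := of_pieces (fun j => (cell_slope v j)%:P).

Lemma lin_interp_Vh v : (1 <= k)%N -> in_Vh k N x_ (lin_interp v).
Proof.
move=> k1; apply: (rep_in_Vh _ _ _ _ _ (of_pieces_rep _)) => j jN.
rewrite (leq_trans (size_polyD _ _)) // geq_max (leq_trans (size_polyC_leq1 _)) //=.
by rewrite (leq_trans (size_scale_leq _ _)) // size_XsubC.
Qed.

Lemma slope_fun_Vh v : in_Vh k N x_ (slope_fun v).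
Proof.
apply: (rep_in_Vh _ _ _ _ _ (of_pieces_rep _)) => j jN.
exact: leq_trans (size_polyC_leq1 _) _.
Qed.

Lemma lin_interpE v j y : (j < N)%N -> x_ j < y < x_ j.+1 ->
  lin_interp v y = v (x_ j) + cell_slope v j * (y - x_ j).
Proof.
move=> jN yj; rewrite /lin_interp (rep_eq _ _ _ _ _ _ (of_pieces_rep _) jN yj).
by rewrite hornerD hornerZ hornerXsubC hornerC.
Qed.

Lemma slope_funE v j y : (j < N)%N -> x_ j < y < x_ j.+1 ->
  slope_fun v y = cell_slope v j.
Proof.
by move=> jN yj; rewrite /slope_fun (rep_eq _ _ _ _ _ _ (of_pieces_rep _) jN yj) hornerC.
Qed.

(* Integration by parts cell by cell; the interface terms cancel because
   [lin_interp v] is continuous. *)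
Lemma DG_form_lin_interp c v phi : periodic v 1 -> in_Vh k N x_ phi ->
  DG_form c N x_ (lin_interp v) phi = - c * ip (slope_fun v) phi.
Proof.
move=> pv /in_Vh_rep[P rP _].
rewrite (DG_form_rep _ _ hm _ _ _ _ _ (of_pieces_rep _) rP).
rewrite (ip_rep _ _ hm _ _ _ _ (of_pieces_rep _) rP) mulr_sumr.
apply: eq_bigr => -[j jN] _ /=; have s := mesh_step _ _ hm _ jN.
pose V := (v (x_ j))%:P + cell_slope v j *: ('X - (x_ j)%:P).
rewrite -/V.
have E := poly_integral_deriv _ _ (V * P j) s.
rewrite derivM poly_integralD !hornerM in E.
have dV : V^`() = (cell_slope v j)%:P.
  by rewrite derivD derivC add0r derivZ derivXsubC -mul_polyC mulr1.
have sj : forall i, (i < N)%N -> cell_slope v i * (x_ i.+1 - x_ i) = v (x_ i.+1) - v (x_ i).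
  by move=> i /(mesh_step _ _ hm) si; rewrite divfK // gt_eqF // subr_gt0.
have Va : V.[x_ j] = v (x_ j) by rewrite /V !hornerE subrr mulr0 addr0.
(* Both traces at [x_ j] are the nodal value; for [j = 0] this uses [v 1 = v 0]. *)
rewrite (_ : inflow _ _ _ _ = v (x_ j)); last first.
  rewrite /inflow hornerD hornerZ hornerXsubC hornerC sj; last exact: prev_cell_lt.
  rewrite addrC subrK; case: (j) jN => [|i] //= N0; rewrite (ltn_predK N0).
  by have [-> -> _] := hm; rewrite -[1]add0r pv.
rewrite dV Va in E; apply/eqP; rewrite -subr_eq0; apply/eqP.
transitivity (c * ((poly_integral (x_ j) (x_ j.+1) ((cell_slope v j)%:P * P j)
    + poly_integral (x_ j) (x_ j.+1) (V * (P j)^`())) -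
   (V.[x_ j.+1] * (P j).[x_ j.+1] - v (x_ j) * (P j).[x_ j]))); first ring.
by rewrite E subrr mulr0.
Qed.

(** A piecewise constant integrates against [phi_x] to boundary terms, and what is left in each cell
    is the jump of the slope times a trace of [phi]. *)
Lemma DG_form_slope_bound c v phi : 0 <= c -> in_Vh k N x_ phi ->
  `|DG_form c N x_ (slope_fun v) phi| <= c * (`|Ci| / Num.sqrt h) *
   Num.sqrt (\sum_(j < N) (cell_slope v j - cell_slope v (prev_cell N j)) ^+ 2) * nrm phi.
Proof.
move=> c0 /in_Vh_rep[P rP sP].
rewrite (DG_form_rep _ _ hm _ _ _ _ _ (of_pieces_rep _) rP).
have -> : DG_poly N x_ c (fun j => (cell_slope v j)%:P) P = - c *
   \sum_(j < N) (cell_slope v j - cell_slope v (prev_cell N j)) * (P j).[x_ j].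
  rewrite mulr_sumr; apply: eq_bigr => -[j jN] _ /=.
  rewrite mul_polyC poly_integralZ (poly_integral_deriv _ _ _ (mesh_step _ _ hm _ jN)).
  by rewrite /inflow !hornerC; ring.
rewrite mulNr normrN normrM (ger0_norm c0).
set S := Num.sqrt (\sum_(j < N) (_ - _) ^+ 2).
rewrite (_ : c * _ * S * _ = c * (S * (`|Ci| / Num.sqrt h * nrm phi))); last by ring.
rewrite ler_wpM2l //.
apply: le_trans (sum_cauchy_schwarz N (fun j => cell_slope v j - cell_slope v (prev_cell N j))
   (fun j => (P j).[x_ j])) _.
rewrite ler_wpM2l ?sqrtr_ge0 //.
apply: trace_sum => // j jN; rewrite lexx ltW //; exact: (mesh_step _ _ hm).
Qed.

End Bounds.

(** * Bounded variation of the derivative *)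

Section OneVariable.
Context {R : realType}.
Implicit Types (f v : R -> R).

Lemma lipschitz_bound f : [lipschitz f x | x in setT] ->
  exists2 K, 0 <= K & forall x y, `|f x - f y| <= K * `|x - y|.
Proof.
move=> [M [_ H]]; exists (Num.max 0 M + 1); first by rewrite addr_ge0 ?le_max ?lexx.
move=> x y; apply: (H _ _ (x, y)) => //.
by rewrite ltr_pwDr // le_max lexx orbT.
Qed.

Lemma lipschitz_continuous f (K : R) : (forall x y, `|f x - f y| <= K * `|x - y|) ->
  continuous f.
Proof.
move=> fK x; apply/cvgrPdist_lt => e e0.
near=> y; apply: le_lt_trans (fK x y) _.
have K0 : 0 <= `|K| + 1 by rewrite addr_ge0.
apply: (@le_lt_trans _ _ ((`|K| + 1) * `|x - y|)).
  by rewrite ler_wpM2r // (le_trans (ler_norm _)) // lerDl.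
rewrite mulrC -ltr_pdivlMr ?ltr_pwDr //; near: y.
by apply: cvgr_dist_lt; rewrite ?divr_gt0 ?ltr_pwDr.
Unshelve. all: by end_near. Qed.

Lemma derivable_continuous f x : derivable f x 1 -> {for x, continuous f}.
Proof. by move=> df; apply: differentiable_continuous; exact/derivable1_diffP. Qed.

Lemma mean_value f (a b x y : R) :
  (forall z, a <= z <= b -> derivable f z 1) -> a <= x <= b -> a <= y <= b ->
  exists2 z, a <= z <= b & f y - f x = derive1 f z * (y - x).
Proof.
move=> df; wlog xy : x y / x <= y.
  move=> H hx hy; case: (leP x y) => [xy|/ltW yx]; first exact: H.
  have [z hz E] := H _ _ yx hy hx; exists z => //.
  by rewrite -opprB E -mulrN opprB.
move=> /andP[ax xb] /andP[ay yb].
have [z||z] := @MVT_segment R f (derive1 f) x y xy.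
- rewrite in_itv /= => /andP[xz zy]; rewrite derive1E; apply: derivableP.
  by apply: df; rewrite (le_trans ax (ltW xz)) (le_trans (ltW zy) yb).
- apply: derivable_within_continuous => z; rewrite in_itv /= => /andP[xz zy].
  by apply: df; rewrite (le_trans ax xz) (le_trans zy yb).
- rewrite in_itv /= => /andP[xz zy] E; exists z => //.
  by rewrite (le_trans ax xz) (le_trans zy yb).
Qed.

(* Landau's inequality on an interval: the maximum M of |f'| is compared with a
   mean value of f' over a subinterval of length (b - a) / (2 (C + 1)), on which
   f' varies by at most M / 2 + B (b - a)^(n+1) / 2 by the induction hypothesis. *)
Lemma landau_inequality n : exists2 C : R, 0 <= C &
  forall f (a b A B : R), a < b -> 0 <= A -> 0 <= B ->
  (forall i x, (i < n.+1)%N -> a <= x <= b -> derivable (derive1n i f) x 1) ->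
  (forall x, a <= x <= b -> `|f x| <= A) ->
  (forall x, a <= x <= b -> `|derive1n n.+1 f x| <= B) ->
  forall x, a <= x <= b -> `|derive1 f x| <= C * (A / (b - a) + B * (b - a) ^+ n).
Proof.
elim: n => [|n [C C0 IH]].
  exists 1 => // f a b A B ab A0 B0 _ _ fB x xab.
  rewrite mul1r expr0 mulr1 (le_trans (fB x xab)) // lerDr.
  by rewrite divr_ge0 // subr_ge0 ltW.
exists (8 * (C + 1)) => [|f a b A B ab A0 B0 df fA fB x xab]; first by lra.
have d0 : 0 < b - a by rewrite subr_gt0.
have df1 z : a <= z <= b -> derivable f z 1 by move=> /(df 0%N); apply.
have df2 z : a <= z <= b -> derivable (derive1 f) z 1 by move=> /(df 1%N); apply.
have cf : {within `[a, b], continuous (fun z => `|derive1 f z|)}.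
  have cf1 : {within `[a, b], continuous (derive1 f)}.
    by apply: derivable_within_continuous => z; rewrite in_itv /=; exact: df2.
  by move=> z; apply: cvg_norm; exact: cf1.
have [x0 + xM] := EVT_max (ltW ab) cf; rewrite in_itv /= => x0ab.
set M := `|derive1 f x0| in xM.
have M0 : 0 <= M by exact: normr_ge0.
have fM z : a <= z <= b -> `|derive1 f z| <= M by move=> zab; apply: xM; rewrite in_itv.
have f2 := IH (derive1 f) a b M B ab M0 B0.
have {}f2 z : a <= z <= b -> `|derive1 (derive1 f) z| <= C * (M / (b - a) + B * (b - a) ^+ n).
  apply: f2 => // [i y iN yab|y yab]; first by rewrite -derive1Sn; exact: df.
  by rewrite -derive1Sn; exact: fB.
pose e := (b - a) / (2 * (C + 1)).
have e0 : 0 < e by rewrite divr_gt0 // mulr_gt0 // ltr_pwDr.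
have ed : e <= (b - a) / 2.
  by rewrite /e ler_pM2l // lef_pV2 ?posrE ?mulr_gt0 ?ltr_pwDr //; lra.
(* A window of length [e] with [x0] as one end: to the right if it fits, else to the left, which
   works since [e <= (b - a) / 2]. *)
have [lo [lo1 lo2 lo3]] : exists lo, [/\ a <= lo, lo + e <= b & lo <= x0 <= lo + e].
  case: (leP (x0 + e) b) => xe; [exists x0|exists (x0 - e)]; split=> //; try lra.
have [|||z zlo zE] := mean_value f lo (lo + e) lo (lo + e).
- by move=> z /andP[z1 z2]; apply: df1; lra.
- by rewrite lexx; lra.
- by rewrite lexx; lra.
have fz : `|derive1 f z| * e <= 2 * A.
  rewrite -[X in _ * X](gtr0_norm e0) -normrM.
  have -> : derive1 f z * e = f (lo + e) - f lo by rewrite zE; ring.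
  rewrite (le_trans (ler_normB _ _)) //.
  have := fA (lo + e); have := fA lo; lra.
have zab : a <= z <= b by lra.
have [w wab wE] := mean_value (derive1 f) a b z x0 df2 zab x0ab.
have fw := f2 w wab.
set d := b - a in d0 ed fw *.
have Ee : 2 * (C + 1) * e = d by rewrite /e mulrC divfK // gt_eqF // mulr_gt0 // ltr_pwDr.
have Mz : M <= `|derive1 f z| + C * (M / d + B * d ^+ n) * e.
  rewrite {1}/M -[derive1 f x0 in leLHS](subrK (derive1 f z)) addrC wE.
  rewrite (le_trans (ler_normD _ _)) // lerD2l normrM ler_pM //.
  by rewrite ler_norml; lra.
have K : C * (M / d + B * d ^+ n) * e <= (M + B * d ^+ n.+1) / 2.
  have -> : C * (M / d + B * d ^+ n) * e = (C / (C + 1)) * ((M + B * d ^+ n.+1) / 2).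
    by rewrite /e -/d exprS; field; rewrite !gt_eqF //; lra.
  rewrite -[leRHS]mul1r ler_wpM2r //.
    by rewrite divr_ge0 // addr_ge0 // mulr_ge0 // exprn_ge0 // ltW.
  by rewrite ler_pdivrMr ?mul1r; lra.
have xM' := fM x xab.
have Az : `|derive1 f z| <= 4 * (C + 1) * (A / d).
  rewrite mulrA ler_pdivlMr // -Ee; have C1 : 0 <= 2 * (C + 1) by lra.
  have := ler_wpM2l C1 fz; lra.
have BD : 0 <= B * d ^+ n.+1 by rewrite mulr_ge0 // exprn_ge0 // ltW.
have CB : 0 <= C * (B * d ^+ n.+1) by rewrite mulr_ge0.
have -> : 8 * (C + 1) * (A / d + B * d ^+ n.+1) = 2 * (4 * (C + 1) * (A / d)) +
  8 * (C * (B * d ^+ n.+1)) + 8 * (B * d ^+ n.+1) by ring.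
lra.
Qed.


End OneVariable.

(** * A monotone majorant of the oscillation of a piecewise smooth derivative *)

Section SlopeVariation.
Context {R : realType}.
Implicit Types (f v W : R -> R) (Z : seq R).

(** The interval is split at each exceptional point that it contains; continuity glues the mean
    value estimates together. *)
Lemma increment_lower_bound Z f (s x y : R) : continuous f -> x <= y ->
  (forall z, x < z < y -> z \notin Z -> derivable f z 1 /\ s <= derive1 f z) ->
  s * (y - x) <= f y - f x.
Proof.
move=> cf; elim: Z x y => [|z0 Z IH] x y xy H.
  move: xy; rewrite le_eqVlt => /predU1P[->|xy]; first by rewrite !subrr mulr0.
  have [z||z] := @MVT R f (derive1 f) x y xy.
  - rewrite in_itv /= => zxy; rewrite derive1E; apply: derivableP.
    by have [] := H z zxy.
  - exact: continuous_subspaceT.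
  rewrite in_itv /= => zxy ->; rewrite ler_wpM2r ?subr_ge0 ?(ltW xy) //.
  by have [] := H z zxy.
have [/andP[xz zy]|nz] := boolP (x < z0 < y).
  have h1 : s * (z0 - x) <= f z0 - f x.
    apply: IH => [|z /andP[z1 z2] zZ]; first exact: ltW.
    by apply: H; rewrite ?z1 ?(lt_trans z2) // inE negb_or zZ lt_eqF.
  have h2 : s * (y - z0) <= f y - f z0.
    apply: IH => [|z /andP[z1 z2] zZ]; first exact: ltW.
    by apply: H; rewrite ?z2 ?(lt_trans xz) // inE negb_or zZ gt_eqF.
  lra.
apply: IH => // z zxy zZ; apply: H => //; rewrite inE negb_or zZ andbT.
by apply/eqP => zE; move: nz; rewrite -zE zxy.
Qed.

Lemma increment_upper_bound Z f (s x y : R) : continuous f -> x <= y ->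
  (forall z, x < z < y -> z \notin Z -> derivable f z 1 /\ derive1 f z <= s) ->
  f y - f x <= s * (y - x).
Proof.
move=> cf xy H.
have cNf : continuous (- f) by move=> z; apply: continuousN; exact: cf.
have := increment_lower_bound Z (- f) (- s) x y cNf xy.
rewrite !fctE => /(_ _); rewrite mulNr -opprD lerN2; apply.
move=> z zxy zZ; have [df fs] := H z zxy zZ.
by split; [exact: derivableN|rewrite derive1E deriveN // -derive1E lerN2].
Qed.

(** Finds the neighbour of [x] in an unsorted list; [min_above] is its mirror image under
    negation. *)
Lemma max_below Z (t x : R) : t \in Z -> t < x ->
  exists2 z, z \in Z & t <= z < x /\ (forall z', z' \in Z -> z' < x -> z' <= z).
Proof.
elim: Z t => // z0 Z IH t; rewrite inE => /predU1P[-> {t}|tZ] tx.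
  have [[t tZ t0]|nt] := pselect (exists2 t, t \in Z & z0 <= t < x).
    have /andP[t1 t2] := t0; have [z zZ [/andP[z1 z2] zM]] := IH t tZ t2.
    exists z; rewrite ?inE ?zZ ?orbT // z2 (le_trans t1 z1); split => // z'.
    by rewrite inE => /predU1P[-> _|/zM//]; exact: le_trans z1.
  exists z0; rewrite ?inE ?eqxx // lexx; split => // z'.
  rewrite inE => /predU1P[->//|z'Z z'x]; rewrite leNgt; apply/negP => lt.
  by apply: nt; exists z' => //; rewrite ltW.
have [z zZ [/andP[z1 z2] zM]] := IH t tZ tx.
case: (boolP (z < z0 < x)) => [/andP[zz0 z0x]|nz].
  exists z0; rewrite ?inE ?eqxx // z0x (le_trans z1 (ltW zz0)); split => // z'.
  rewrite inE => /predU1P[->//|z'Z z'x]; exact: le_trans (zM _ z'Z z'x) (ltW zz0).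
exists z; rewrite ?inE ?zZ ?orbT // z1 z2; split => // z'.
rewrite inE => /predU1P[-> z0x|/zM//]; rewrite leNgt; apply/negP => lt.
by move: nz; rewrite lt z0x.
Qed.

Lemma min_above Z (t x : R) : t \in Z -> x < t ->
  exists2 z, z \in Z & x < z <= t /\ (forall z', z' \in Z -> x < z' -> z <= z').
Proof.
move=> tZ xt; have := max_below [seq - z | z <- Z] (- t) (- x).
rewrite (map_f _ tZ) ltrN2 xt => /(_ isT isT)[_ /mapP[z zZ ->] [zx zM]].
exists z => //; split; first by move: zx; rewrite lerN2 ltrN2 andbC.
by move=> z' z'Z xz'; rewrite -lerN2; apply: zM; rewrite ?map_f // ltrN2.
Qed.

Lemma le_sum_mem Z (F : R -> R) t : (forall z, 0 <= F z) -> t \in Z ->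
  F t <= \sum_(z <- Z) F z.
Proof.
move=> F0; elim: Z => // z Z IH; rewrite inE big_cons => /predU1P[->|/IH h].
  by rewrite lerDl sumr_ge0.
by rewrite (le_trans h) // lerDr.
Qed.

(** The affine rise from 0 to 1 on [z, z']. It is set to 0 for pairs in the wrong order, so that a
    double sum over all of [Z] makes sense. *)
Definition ramp (z z' x : R) : R :=
  if z < z' then (Num.min z' (Num.max z x) - z) / (z' - z) else 0.

Lemma ramp_homo z z' x y : x <= y -> ramp z z' x <= ramp z z' y.
Proof.
rewrite /ramp => xy; case: ifP => // zz'.
rewrite ler_wpM2r ?invr_ge0 ?subr_ge0 ?(ltW zz') // lerB // le_min2 // le_max2 //.
Qed.

Lemma ramp_diff_le1 z z' x y : ramp z z' y - ramp z z' x <= 1.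
Proof.
rewrite /ramp; case: ifP => [zz'|_]; last by rewrite subrr.
rewrite -mulrBl ler_pdivrMr ?subr_gt0 // mul1r.
have : Num.min z' (Num.max z y) <= z' by rewrite ge_min lexx.
have : z <= Num.min z' (Num.max z x) by rewrite le_min (ltW zz') le_max lexx.
lra.
Qed.

Lemma ramp_inside z z' x : z < x < z' -> ramp z z' x = (x - z) / (z' - z).
Proof.
move=> /andP[zx xz]; rewrite /ramp (lt_trans zx xz).
by rewrite max_r ?min_r // ltW.
Qed.

(* Jumps of size 2 L at the points of Z bound the jumps of a function of size at
   most L, and the slope K / (z' - z) between consecutive points of Z bounds its
   derivative; summing over all pairs of Z avoids sorting Z. *)
Definition variation_bound Z (L K x : R) : R :=
  \sum_(z <- Z) (2 * L) * (z <= x)%R%:R +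
  \sum_(z <- Z) \sum_(z' <- Z) K * ramp z z' x.

(** Every summand is nondecreasing, so one well chosen summand suffices to dominate an increment of
    [w]. Each indicator and each ramp rises by at most 1 in total, which gives the last bound. *)
Lemma variation_boundP Z (L K : R) (w : R -> R) (a b : R) : 0 <= L -> 0 <= K ->
  a \in Z -> b \in Z ->
  (forall x, a < x < b -> x \notin Z -> `|w x| <= L) ->
  (forall z z', z \in Z -> z' \in Z -> z < z' -> a <= z -> z' <= b ->
     (forall t, z < t < z' -> t \notin Z) ->
     forall x y, z < x -> x <= y -> y < z' -> `|w x - w y| <= K * (y - x) / (z' - z)) ->
  [/\ forall x y, x <= y -> variation_bound Z L K x <= variation_bound Z L K y,
      forall x y, a < x -> x <= y -> y < b -> x \notin Z -> y \notin Z ->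
        `|w x - w y| <= variation_bound Z L K y - variation_bound Z L K x
    & forall x y, variation_bound Z L K y - variation_bound Z L K x <=
        2 * L * (size Z)%:R + K * (size Z * size Z)%:R].
Proof.
move=> L0 K0 aZ bZ wL wK.
have E x y : variation_bound Z L K y - variation_bound Z L K x =
   \sum_(z <- Z) (2 * L) * ((z <= y)%R%:R - (z <= x)%R%:R) +
   \sum_(z <- Z) \sum_(z' <- Z) K * (ramp z z' y - ramp z z' x).
  rewrite /variation_bound opprD addrACA -!sumrB; congr (_ + _).
    by apply: eq_bigr => z _; rewrite mulrBr.
  apply: eq_bigr => z _; rewrite -sumrB.
  by apply: eq_bigr => z' _; rewrite mulrBr.
have J (x y z : R) : x <= y -> 0 <= (2 * L) * ((z <= y)%R%:R - (z <= x)%R%:R) :> R.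
  move=> xy; rewrite mulr_ge0 ?mulr_ge0 // subr_ge0 ler_nat.
  by case: (boolP (z <= x)) => // zx; rewrite (le_trans zx xy).
have Q x y z z' : x <= y -> 0 <= K * (ramp z z' y - ramp z z' x).
  by move=> xy; rewrite mulr_ge0 // subr_ge0 ramp_homo.
have S1 x y : x <= y -> 0 <= \sum_(z <- Z) (2 * L) * ((z <= y)%R%:R - (z <= x)%R%:R) :> R.
  by move=> xy; apply: sumr_ge0 => z _; exact: J.
have S2' x y z : x <= y -> 0 <= \sum_(z' <- Z) K * (ramp z z' y - ramp z z' x).
  by move=> xy; apply: sumr_ge0 => z' _; exact: Q.
have S2 x y : x <= y -> 0 <= \sum_(z <- Z) \sum_(z' <- Z) K * (ramp z z' y - ramp z z' x).
  by move=> xy; apply: sumr_ge0 => z _; exact: S2'.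
split=> [x y xy|x y ax xy yb xZ yZ|x y].
- by rewrite -subr_ge0 E addr_ge0 ?S1 ?S2.
(* If a point of [Z] separates [x] and [y], its jump term pays for the trivial bound [2 * L];
   otherwise both lie in one gap, and the ramp of that gap pays. *)
- rewrite E; have [[t tZ /andP[xt ty]]|nt] := pselect (exists2 t, t \in Z & x <= t <= y).
    have xt' : (t <= x) = false.
      by apply/negbTE; rewrite -ltNge lt_neqAle xt andbT; apply: contra xZ => /eqP ->.
    apply: (@le_trans _ _ (2 * L)).
      have := wL x; have := wL y; rewrite ax yb (lt_le_trans ax xy) (le_lt_trans xy yb).
      move=> /(_ isT yZ) wy /(_ isT xZ) wx; rewrite (le_trans (ler_normB _ _)) //; lra.
    rewrite -[leLHS]addr0 lerD ?S2 //.
    have := le_sum_mem _ (fun z => (2 * L) * ((z <= y)%R%:R - (z <= x)%R%:R)) _ (fun z => J x y z xy) tZ.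
    by rewrite /= ty xt' subr0 mulr1.
  have [z zZ [/andP[az zx] zM]] := max_below _ _ _ aZ ax.
  have [z' z'Z [/andP[yz' z'b] z'M]] := min_above _ _ _ bZ yb.
  have zz' : z < z' by lra.
  have no t : z < t < z' -> t \notin Z.
    move=> /andP[zt tz']; apply/negP => tZ; have [tx|xt] := ltP t x.
      by have := zM _ tZ tx; rewrite leNgt zt.
    have [yt|ty] := ltP y t; first by have := z'M _ tZ yt; rewrite leNgt tz'.
    by apply: nt; exists t => //; rewrite xt.
  apply: le_trans (wK z z' zZ z'Z zz' az z'b no x y zx xy yz') _.
  rewrite -[leLHS]add0r lerD ?S1 //.
  apply: le_trans (le_sum_mem _ (fun z => \sum_(z' <- Z) K * (ramp z z' y - ramp z z' x))
    _ (fun z => S2' x y z xy) zZ).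
  apply: le_trans (le_sum_mem _ (fun z' => K * (ramp z z' y - ramp z z' x))
    _ (fun z' => Q x y z z' xy) z'Z).
  rewrite !ramp_inside ?(le_lt_trans xy) ?(lt_le_trans zx) ?zx //.
  by rewrite -mulrBl -mulrA ler_wpM2l // ler_wpM2r ?invr_ge0 ?subr_ge0 ?(ltW zz') //; lra.
- rewrite E lerD //.
    apply: (@le_trans _ _ (\sum_(z <- Z) (2 * L))).
      apply: ler_sum => z _; rewrite -[leRHS]mulr1 ler_wpM2l ?mulr_ge0 //.
      by case: (z <= y); case: (z <= x); rewrite /=; lra.
    by rewrite big_const_seq count_predT iter_addr_0 mulr_natr.
  apply: (@le_trans _ _ (\sum_(z <- Z) \sum_(z' <- Z) K)).
    apply: ler_sum => z _; apply: ler_sum => z' _.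
    by rewrite -[leRHS]mulr1 ler_wpM2l // ramp_diff_le1.
  by rewrite !big_const_seq !count_predT !iter_addr_0 -mulrnA mulr_natr.
Qed.

End SlopeVariation.

Section SlopeBV.
Context {R : realType}.
Implicit Types (f v W : R -> R) (Z : seq R).

(* The only consequence of the regularity class used below: v' has bounded
   variation, the variation function being W; the oscillation of the difference
   quotients of v on [a, b] is at most W b - W a. *)
Definition slope_bv (B : R) v W :=
  [/\ forall x y, x <= y -> W x <= W y, W 1 - W (-2) <= B &
      forall a b, -2 <= a -> a < b -> b <= 1 -> exists s, forall x y,
        a <= x -> x <= y -> y <= b ->
        s * (y - x) <= v y - v x <= (s + (W b - W a)) * (y - x)].

Let shift_quotient f x : periodic f 1 ->
  (fun h => h^-1 *: ((f \o shift (x + 1)) (h *: 1) - f (x + 1))) =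
  (fun h => h^-1 *: ((f \o shift x) (h *: 1) - f x)) :> (R -> R).
Proof. by move=> pf; apply/funext => h /=; rewrite addrA !pf. Qed.

Lemma derivable_periodic f x : periodic f 1 ->
  derivable f (x + 1) 1 -> derivable f x 1.
Proof. by move=> pf; rewrite /derivable shift_quotient. Qed.

Lemma derive1_periodic f : periodic f 1 -> periodic (derive1 f) 1.
Proof. by move=> pf x; rewrite !derive1E /derive shift_quotient. Qed.

Lemma derive1n_periodic f n : periodic f 1 -> periodic (derive1n n f) 1.
Proof.
by move=> pf; elim: n => [//|n IH]; rewrite derive1nS; exact: derive1_periodic.
Qed.

Lemma card_le_seq (A : set R) p : (A #<= `I_p)%card ->
  exists2 s : seq R, size s = p & forall x, A x -> x \in s.
Proof.
move=> /pcard_surjP[f fA]; exists [seq f i | i <- iota 0 p]; first by rewrite size_map size_iota.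
move=> x /fA[i ip <-]; apply: map_f; rewrite mem_iota; exact: ip.
Qed.

Definition regular_bound (m : nat) (L c0 : R) v (x : R) :=
  [/\ forall i, (i < m)%N -> derivable (derive1n i v) x 1,
      `|derive1n m v x| <= c0 & `|derive1 v x| <= L].

Lemma regular_bound_periodic m L c0 v x : periodic v 1 ->
  regular_bound m L c0 v (x + 1) -> regular_bound m L c0 v x.
Proof.
move=> pv [dv]; rewrite (derive1n_periodic v m pv x) (derive1_periodic v pv x) => h1 h2.
split=> [i im||//]; last exact: h1.
exact: (derivable_periodic _ _ (derive1n_periodic v i pv) (dv i im)).
Qed.

(** At a regular point both derivatives are continuous, so the essential bounds hold there
    pointwise. *)
Lemma regular_at_bound m p L c0 v x : (1 < m)%N -> piecewise_class m p L c0 v ->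
  0 < x < 1 -> regular_at m v x -> regular_bound m L c0 v x.
Proof.
move=> m1 [_ _ vL _ vc] x01 /nbhs_singleton[dv cv]; split=> //.
  exact: normLoo_le_at vc x01 cv.
apply: normLoo_le_at vL x01 _.
exact: (derivable_continuous _ _ (dv 1%N m1)).
Qed.

(** Three periods are covered because later arguments reach back to [x - 2 * dl] with [x] in [0, 1]
    and [dl <= 1]. This takes three copies of the singular points, and the four integers, where the
    essential bounds on ]0, 1[ say nothing directly. *)
Lemma exceptional_points m p L c0 v : (1 < m)%N -> piecewise_class m p L c0 v ->
  exists Z, [/\ size Z = (3 * p + 4)%N, -2 \in Z, 1 \in Z &
    forall x, -2 < x < 1 -> x \notin Z -> regular_bound m L c0 v x].
Proof.
move=> m1 cv; have [pv _ _ cA _] := cv.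
have [s sp sA] := card_le_seq _ _ cA.
exists [:: -2, 1, -1, 0 & s ++ [seq x - 1 | x <- s] ++ [seq x - 2 | x <- s]].
split; rewrite ?inE ?eqxx ?orbT //.
  by rewrite /= !size_cat !size_map sp mulSn mulSn mul1n !addnA addn4.
move=> x /andP[x2 x1]; rewrite !inE !mem_cat !negb_or.
move=> /and5P[_ _ xm1 x0 /and3P[xs xs1 xs2]].
have base y : 0 < y < 1 -> y \notin s -> regular_bound m L c0 v y.
  move=> /andP[y0 y1] ys; apply: (regular_at_bound _ _ _ _ _ _ m1 cv); first by rewrite y0.
  by apply: contrapT => nr; move/negP: ys; apply; apply: sA; split; rewrite ?(ltW y0).
have [x0'|x0'|xE] := ltgtP x 0; last by rewrite xE eqxx in x0.
  have [x1'|x1'|xE] := ltgtP x (-1); last by rewrite xE eqxx in xm1.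
    do 2 apply: regular_bound_periodic => //; apply: base; first lra.
    by apply: contra xs2 => /(map_f (fun t => t - 2)) /=; rewrite (_ : x + 1 + 1 - 2 = x) //; lra.
  apply: regular_bound_periodic => //; apply: base; first lra.
  by apply: contra xs1 => /(map_f (fun t => t - 1)) /=; rewrite addrK.
by apply: base => //; rewrite x0'.
Qed.

(** On a gap of length d between consecutive exceptional points, Landau's inequality for [v'] gives
    |v''| <= K / d. The variation of [v'] over the gap is then at most K for every d, so B depends
    on the constants of the class only. *)
Lemma piecewise_class_slope_bv m p (L c0 : R) : (3 <= m)%N ->
  exists2 B, 0 <= B & forall v, piecewise_class m p L c0 v -> exists W, slope_bv B v W.
Proof.
move=> m3; have [n mE] : exists n, m = n.+2 by exists (m - 2)%N; case: (m) m3 => [|[|k]] // _; rewrite subn2.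
have n1 : (0 < n)%N by rewrite mE in m3.
have [C C0 landau] := @landau_inequality R n.
(* Landau is applied on intervals of length between d / 2 and d, with d <= 3: hence the 2, the power
   of 3, and the last factor from 1 <= 3 / d. *)
pose K := C * (2 * `|L| + `|c0| * 3 ^+ n * 3).
pose q := (3 * p + 4)%N.
have K0 : 0 <= K by rewrite mulr_ge0 // addr_ge0 ?mulr_ge0 // exprn_ge0.
exists (2 * `|L| * q%:R + K * (q * q)%:R).
  by rewrite addr_ge0 // !mulr_ge0 // ler0n.
move=> v cv; have [pv lv _ _ _] := cv.
have m1 : (1 < m)%N by rewrite mE.
have [Z [sZ Z2 Z1 good]] := exceptional_points _ _ _ _ _ m1 cv.
have [K1 _ vK1] := lipschitz_bound _ lv.
have contv := lipschitz_continuous _ _ vK1.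
have wL x : -2 < x < 1 -> x \notin Z -> `|derive1 v x| <= `|L|.
  by move=> hx xZ; have [_ _ h] := good x hx xZ; rewrite (le_trans h) // ler_norm.
have wK z z' : z \in Z -> z' \in Z -> z < z' -> -2 <= z -> z' <= 1 ->
     (forall t, z < t < z' -> t \notin Z) ->
     forall x y, z < x -> x <= y -> y < z' ->
     `|derive1 v x - derive1 v y| <= K * (y - x) / (z' - z).
  move=> _ _ zz' z2 z1 nZ x y zx xy yz'.
  set d := z' - z; have d0 : 0 < d by rewrite subr_gt0.
  (* [x, y] is enlarged to length at least d / 2 while remaining strictly inside the gap, where
     every point is regular. *)
  pose a := Num.min x (z + d / 4); pose b := Num.max y (z' - d / 4).
  have az : z < a by rewrite lt_min zx; lra.
  have bz : b < z' by rewrite gt_max yz'; lra.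
  have a1 : a <= z + d / 4 by rewrite ge_min lexx orbT.
  have b1 : z' - d / 4 <= b by rewrite le_max lexx orbT.
  have ax : a <= x by rewrite ge_min lexx.
  have yb : y <= b by rewrite le_max lexx.
  have ab : a < b by rewrite /d in a1 b1; lra.
  have inner t : a <= t <= b -> regular_bound m L c0 v t.
    by move=> /andP[h1 h2]; apply: good; [|apply: nZ]; lra.
  have B2 t : a <= t <= b -> `|derive1 (derive1 v) t| <= K / d.
    move=> tab; have := landau (derive1 v) a b `|L| `|c0| ab (normr_ge0 _) (normr_ge0 _).
    move=> /(_ _ _ _ t tab) h; apply: le_trans (h _ _ _) _ => {h}.
    - move=> i s' im sab; rewrite -derive1Sn; have [+ _ _] := inner _ sab; apply.
      by rewrite mE ltnS.
    - by move=> s' sab; have [_ _ h] := inner _ sab; rewrite (le_trans h) // ler_norm.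
    - move=> s' sab; rewrite -derive1Sn -mE; have [_ h _] := inner _ sab.
      by rewrite (le_trans h) // ler_norm.
    rewrite /K -mulrA ler_wpM2l // mulrDl lerD //.
      rewrite (_ : 2 * _ / d = `|L| * (2 / d)); last by ring.
      apply: ler_wpM2l => //; rewrite ler_pdivlMr // mulrC ler_pdivrMr ?subr_gt0 //.
      by rewrite /d in a1 b1 *; lra.
    rewrite -!mulrA ler_wpM2l // -[leLHS]mulr1.
    apply: ler_pM; rewrite ?exprn_ge0 ?subr_ge0 ?(ltW ab) //.
      by rewrite lerXn2r ?nnegrE ?subr_ge0 ?(ltW ab) //; lra.
    by rewrite ler_pdivlMr // mul1r /d; lra.
  have dv' t : a <= t <= b -> derivable (derive1 v) t 1.
    by move=> /inner[+ _ _] => /(_ 1%N m1).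
  have hy : a <= y <= b by lra.
  have hx : a <= x <= b by lra.
  have [t tab ->] := mean_value _ _ _ _ _ dv' hy hx.
  rewrite normrM distrC (ger0_norm (_ : 0 <= y - x)) ?subr_ge0 //.
  rewrite mulrAC; apply: ler_wpM2r; rewrite ?subr_ge0 //; exact: B2.
have [mono wW size_] := variation_boundP Z `|L| K (derive1 v) (-2) 1 (normr_ge0 _) K0 Z2 Z1 wL wK.
exists (variation_bound Z `|L| K); split => // [|a b a2 ab b1].
  by rewrite /q -sZ; exact: size_.
set W := variation_bound Z `|L| K.
have dW x y : a < x < b -> a < y < b -> x \notin Z -> y \notin Z ->
    derive1 v x <= derive1 v y + (W b - W a).
  move=> hx hy xZ yZ.
  have : `|derive1 v x - derive1 v y| <= W b - W a.
    wlog xy : x y hx hy xZ yZ / x <= y.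
      move=> H; case: (leP x y) => [|/ltW] xy; first exact: H.
      by rewrite distrC; exact: H.
    have := wW x y; rewrite (_ : -2 < x); last by lra.
    move=> /(_ isT xy _ xZ yZ) h; apply: le_trans (h _) _; first by lra.
    have xb : y <= b by lra.
    have ax : a <= x by lra.
    by have := mono _ _ xb; have := mono _ _ ax; rewrite /W; lra.
  by have := ler_norm (derive1 v x - derive1 v y); lra.
(* [s] is the infimum of [v'] on ]a, b[ off [Z]. *)
have [s hs] : exists s, forall z, a < z < b -> z \notin Z ->
    s <= derive1 v z <= s + (W b - W a).
  have [[z0 z0ab z0Z]|nz] := pselect (exists2 z, a < z < b & z \notin Z); last first.
    by exists 0 => z zab zZ; exfalso; apply: nz; exists z.
  pose A := [set derive1 v z | z in [set z | a < z < b /\ z \notin Z]].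
  have A0 : A !=set0 by exists (derive1 v z0), z0.
  have lbA z : a < z < b -> z \notin Z -> lbound A (derive1 v z - (W b - W a)).
    move=> zab zZ _ [y [yab yZ] <-]; have := dW z y zab yab zZ yZ; lra.
  exists (inf A) => z zab zZ; apply/andP; split.
    by apply: ge_inf; [exists (derive1 v z0 - (W b - W a)); exact: lbA|exists z].
  by have := lb_le_inf A0 (lbA z zab zZ); lra.
exists s => x y ax xy yb.
have inab z : x < z < y -> a < z < b by move=> /andP[h1 h2]; lra.
have dvz z : x < z < y -> z \notin Z -> derivable v z 1.
  move=> /inab zab zZ; have [|+ _ _] := good z _ zZ; first by lra.
  by move=> /(_ 0%N (ltnW m1)).
apply/andP; split.
  apply: (increment_lower_bound Z) => // z zxy zZ; split; first exact: dvz.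
  by have /andP[] := hs z (inab _ zxy) zZ.
apply: (increment_upper_bound Z) => // z zxy zZ; split; first exact: dvz.
by have /andP[] := hs z (inab _ zxy) zZ.
Qed.

End SlopeBV.

(** * The exact solution and the obstacle *)

Section ExactSolutionFacts.
Context {R : realType}.
Variables (c : R) (g u0 : R -> R) (K : R).
Hypothesis c0 : 0 < c.
Hypothesis gK : forall x y, `|g x - g y| <= K * `|x - y|.

Let K0 : 0 <= K.
Proof. by have := gK 0 1; rewrite sub0r normrN1 mulr1; exact: le_trans. Qed.

Lemma running_max_attained t x : 0 <= t ->
  exists2 th, 0 <= th <= t & running_max c g t x = g (x - c * th) /\
   forall th', 0 <= th' <= t -> g (x - c * th') <= running_max c g t x.
Proof.
move=> t0; have cg : {within `[0, t], continuous (fun th => g (x - c * th))}.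
  apply: continuous_subspaceT; apply: (lipschitz_continuous _ (K * c)) => a b.
  rewrite (le_trans (gK _ _)) // -mulrA ler_wpM2l //.
  rewrite (_ : x - c * a - (x - c * b) = c * (b - a)); last by ring.
  by rewrite normrM gtr0_norm // distrC.
have [th + thM] := EVT_max t0 cg; rewrite in_itv /= => th0t.
have E : running_max c g t x = g (x - c * th).
  apply/le_anti/andP; split.
    apply: ge_sup; first by exists (g (x - c * th)), th; rewrite //= in_itv.
    by move=> _ [a /= a0t <-]; exact: thM.
  apply: ub_le_sup; last by exists th; rewrite //= in_itv.
  by exists (g (x - c * th)) => _ [a /= a0t <-]; exact: thM.
by exists th => //; split => // a a0t; rewrite E; apply: thM; rewrite in_itv.
Qed.

Lemma running_max_ge t x th : 0 <= th <= t -> g (x - c * th) <= running_max c g t x.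
Proof.
move=> th0t; have t0 : 0 <= t by case/andP: th0t; exact: le_trans.
by have [_ _ [_]] := running_max_attained t x t0; apply.
Qed.

Lemma running_max_lipschitz t x y : 0 <= t ->
  `|running_max c g t x - running_max c g t y| <= K * `|x - y|.
Proof.
move=> t0; have H a b : running_max c g t a - running_max c g t b <= K * `|a - b|.
  have [th th0 [-> _]] := running_max_attained t a t0.
  have := running_max_ge t b th th0.
  have := le_trans (ler_norm _) (gK (a - c * th) (b - c * th)).
  by rewrite (_ : a - c * th - (b - c * th) = a - b); [lra|ring].
by rewrite ler_norml; have := H x y; have := H y x; rewrite (distrC y x); lra.
Qed.

Lemma running_maxD t s x : 0 <= t -> 0 <= s ->
  running_max c g (t + s) x = Num.max (running_max c g t (x - c * s)) (running_max c g s x).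
Proof.
move=> t0 s0; apply/le_anti/andP; split.
  have [th th0 [-> _]] := running_max_attained (t + s) x (addr_ge0 t0 s0).
  rewrite le_max; have [ths|sth] := leP th s.
    by rewrite (running_max_ge s x th) ?orbT //; lra.
  have := running_max_ge t (x - c * s) (th - s).
  rewrite (_ : x - c * s - c * (th - s) = x - c * th); last by ring.
  by move=> -> //; lra.
rewrite ge_max; apply/andP; split.
  have [th th0 [-> _]] := running_max_attained t (x - c * s) t0.
  rewrite (_ : x - c * s - c * th = x - c * (th + s)); last by ring.
  by apply: running_max_ge; lra.
have [th th0 [-> _]] := running_max_attained s x s0.
by apply: running_max_ge; lra.
Qed.

(** Dynamic programming: the exact evolution has the same form as a step of the scheme with obstacle
    [running_max c g s]. For [t = 0] it is the definition, for [t > 0] the semigroup property of the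
    running maximum. *)
Lemma exact_solD t s x : 0 <= t -> 0 < s ->
  exact_sol c u0 g (t + s) x =
  Num.max (exact_sol c u0 g t (x - c * s)) (running_max c g s x).
Proof.
move=> t0 s0; rewrite /exact_sol (gt_eqF (_ : 0 < t + s)); last by lra.
case: eqVneq => [->|tn0]; first by rewrite !add0r.
rewrite (running_maxD _ _ _ t0 (ltW s0)) maxA; congr (Num.max (Num.max (u0 _) _) _); ring.
Qed.

(** False in general at [t = 0], where [u0] may lie below [g]; this is what sets the first step
    apart for the two-point obstacle. *)
Lemma exact_sol_ge t x : 0 < t -> g x <= exact_sol c u0 g t x.
Proof.
move=> t0; rewrite /exact_sol (gt_eqF t0) le_max.
have := running_max_ge t x 0; rewrite mulr0 subr0 => -> //; first by rewrite orbT.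
by rewrite lexx ltW.
Qed.

Lemma two_point_max_le t x : 0 <= t -> two_point_max c g t x <= running_max c g t x.
Proof.
move=> t0; rewrite ge_max (running_max_ge t x t) ?lexx ?t0 //.
by have := running_max_ge t x 0; rewrite mulr0 subr0 => -> //; rewrite lexx.
Qed.

(** Crude O(t) bound, affordable once: it serves for the first step only. *)
Lemma two_point_max_close t x : 0 <= t ->
  running_max c g t x - two_point_max c g t x <= K * (c * t).
Proof.
move=> t0; have [th /andP[th0 th1] [-> _]] := running_max_attained t x t0.
have : g x <= two_point_max c g t x by rewrite le_max lexx.
have := le_trans (ler_norm _) (gK (x - c * th) x).
rewrite (_ : x - c * th - x = - (c * th)); last by ring.
rewrite normrN ger0_norm; last by rewrite mulr_ge0 // ltW.
have : K * (c * th) <= K * (c * t) by rewrite ler_wpM2l // ler_wpM2l // ltW.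
lra.
Qed.

(* If the maximum M of g over [x - dl, x] exceeds v (x - dl), g x and
   g (x - dl), it is attained at an interior point y; there w y >= M = w x, so w
   cannot have dropped much between x - dl and x, while w (x - dl) is a value of
   v or g <= v on [x - 2 dl, x - dl].  Hence v (x - dl), squeezed between two
   points where v is almost >= M, is itself close to M. *)
Lemma two_point_max_defect t (v w Wv Ww : R -> R) (Bv Bw : R) x : 0 < t ->
  slope_bv Bv v Wv -> slope_bv Bw w Ww ->
  (forall z, g z <= v z) ->
  (forall z, w z = Num.max (v (z - c * t)) (running_max c g t z)) ->
  -2 <= x - 2 * (c * t) -> x <= 1 ->
  running_max c g t x <= Num.max (v (x - c * t)) (two_point_max c g t x) +
    c * t * ((Wv x - Wv (x - 2 * (c * t))) + (Ww x - Ww (x - 2 * (c * t)))).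
Proof.
move=> t0 [Wv1 _ sv] [Ww1 _ sw] gv wE x2 x1.
set dl := c * t in x2 wE *; have d0 : 0 < dl by rewrite mulr_gt0.
set a := x - 2 * dl in x2 *; have ax : a < x by rewrite /a; lra.
have DV : 0 <= Wv x - Wv a by rewrite subr_ge0 Wv1 // ltW.
have DW : 0 <= Ww x - Ww a by rewrite subr_ge0 Ww1 // ltW.
have dDV : 0 <= dl * (Wv x - Wv a) by rewrite mulr_ge0 // ltW.
have dDW : 0 <= dl * (Ww x - Ww a) by rewrite mulr_ge0 // ltW.
set M := running_max c g t x.
have [MN|MN] := leP M (Num.max (v (x - dl)) (two_point_max c g t x)).
  by rewrite (le_trans MN) // lerDl mulrDr addr_ge0.
suff H : M <= v (x - dl) + dl * ((Wv x - Wv a) + (Ww x - Ww a)).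
  by rewrite (le_trans H) // lerD2r le_max lexx.
move: MN; rewrite !gt_max => /and3P[vM gxM gM].
have [th /andP[th0 tht] [Mth _]] := running_max_attained t x (ltW t0).
rewrite -/M in Mth; set y := x - c * th in Mth.
have th_gt0 : 0 < th.
  rewrite lt0r th0 andbT; apply/eqP => th00; move: gxM; rewrite Mth /y th00.
  by rewrite mulr0 subr0 ltxx.
have yx : y < x by rewrite /y gtrBl mulr_gt0.
have xy : x - dl <= y by rewrite /y lerD2l lerN2 /dl ler_pM2l.
have wx : w x = M by rewrite wE; apply/max_idPr/ltW.
have wy : M <= w y.
  rewrite wE le_max Mth; have := running_max_ge t y 0.
  by rewrite mulr0 subr0 lexx (ltW t0) => -> //; rewrite orbT.
have [z [za zd wz]] : exists z, [/\ a <= z, z <= x - dl & w (x - dl) <= v z].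
  rewrite wE; case: (leP (v (x - dl - dl)) (running_max c g t (x - dl))) => _; last first.
    by exists (x - dl - dl); rewrite /a lexx; split; lra.
  have [r /andP[r0 rt] [-> _]] := running_max_attained t (x - dl) (ltW t0).
  have h1 : 0 <= c * r by rewrite mulr_ge0 // ltW.
  have h2 : c * r <= dl by rewrite /dl ler_pM2l.
  by exists (x - dl - c * r); rewrite gv /a; split; lra.
have [s1 hw] := sw a x x2 ax x1; have [s2 hv] := sv a x x2 ax x1.
have ay : a <= y by rewrite /a; lra.
have ad : a <= x - dl by rewrite /a; lra.
have dx : x - dl <= x by lra.
have /andP[w1 _] := hw y x ay (ltW yx) (lexx x).
have /andP[_ w2] := hw (x - dl) x ad dx (lexx x).
(* [w y >= w x] with [y < x] leaves no room for a positive minimal slope of [w]. *)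
have s1le : s1 <= 0.
  by rewrite -(pmulr_lle0 _ (_ : 0 < x - y)) ?subr_gt0 //; lra.
have MW : M <= v z + dl * (Ww x - Ww a).
  have : (s1 + (Ww x - Ww a)) * dl <= (Ww x - Ww a) * dl by rewrite ler_wpM2r ?(ltW d0) //; lra.
  rewrite (_ : x - (x - dl) = dl) in w2; last by ring.
  rewrite mulrC; lra.
have /andP[v1 _] := hv z (x - dl) za zd dx.
have /andP[_ v2] := hv (x - dl) y ad xy (ltW yx).
have My : M <= v y by rewrite Mth gv.
(* If all slopes of [v] are nonnegative, [v (x - dl)] is at least [v z]; otherwise [v] rises from
   [x - dl] to [y] by at most [dl] times its slope oscillation. Both [v z] and [v y] are almost [M]
   or more. *)
rewrite mulrDr; have [s20|s20] := leP 0 s2.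
  have : 0 <= s2 * (x - dl - z) by rewrite mulr_ge0 // subr_ge0.
  lra.
have : (s2 + (Wv x - Wv a)) * (y - (x - dl)) <= (Wv x - Wv a) * dl.
  apply: (@le_trans _ _ ((Wv x - Wv a) * (y - (x - dl)))).
    by rewrite ler_wpM2r ?subr_ge0 //; lra.
  by rewrite ler_wpM2l //; lra.
rewrite (mulrC dl (Wv x - _)); lra.
Qed.

End ExactSolutionFacts.

(** * One step of the scheme *)

Section OneStep.
Context {R : realType}.
Variables (c : R) (k N : nat) (x_ : nat -> R) (Ci dt : R).
Hypotheses (c0 : 0 < c) (k1 : (1 <= k)%N) (hm : is_mesh N x_).
Hypothesis hinv : inverse_inequalities k N x_ Ci.
Local Notation h := (mesh_size N x_).
Hypotheses (dt0 : 0 < dt) (cfl : dt <= (c * (1 + `|Ci| + 2 * Ci ^+ 2))^-1 * h).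
Local Notation dl := (c * dt).
Implicit Types (f v w W : R -> R).

Let h0 : 0 < h. Proof. exact: (mesh_size_gt0 _ _ hm). Qed.
Let sh0 : 0 < Num.sqrt h. Proof. by rewrite sqrtr_gt0. Qed.
Let dl0 : 0 < dl. Proof. exact: mulr_gt0. Qed.
Let Ci2 : 0 <= Ci ^+ 2. Proof. exact: sqr_ge0. Qed.

(** The summands of the CFL constant: 1 gives [dl <= h], [|Ci| + 2 * Ci ^+ 2] makes [dt] times the
    DG form bounded with constant 1, and [2 * Ci ^+ 2] makes [2 * dl] fit in every cell. *)
Lemma cfl_dl : dl * (1 + `|Ci| + 2 * Ci ^+ 2) <= h.
Proof.
have p : 0 < c * (1 + `|Ci| + 2 * Ci ^+ 2).
  by rewrite mulr_gt0 //; have := normr_ge0 Ci; have := Ci2; lra.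
by move: cfl; rewrite mulrC ler_pdivlMr //; congr (_ <= _); ring.
Qed.

Lemma dl_le_h : dl <= h.
Proof.
apply: le_trans cfl_dl; rewrite ler_peMr ?(ltW dl0) //.
by have := normr_ge0 Ci; have := Ci2; lra.
Qed.

Lemma dl_le_cell j : (j < N)%N -> 2 * dl <= x_ j.+1 - x_ j.
Proof.
move=> jN; have s := mesh_step _ _ hm _ jN.
have q := mesh_quasi_uniform _ _ hm _ _ hinv _ jN.
have := cfl_dl; have c2 := Ci2; have n0 := normr_ge0 Ci.
(* [Ci = 0] would give [h <= 0] by quasi-uniformity. *)
have [C0|Cn0] := eqVneq Ci 0.
  by move=> _; move: q; rewrite C0 expr0n mul0r => q0; have := h0; lra.
have C2 : 0 < Ci ^+ 2 by rewrite exprn_even_gt0.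
have : dl * (2 * Ci ^+ 2) <= dl * (1 + `|Ci| + 2 * Ci ^+ 2).
  by rewrite ler_wpM2l ?(ltW dl0) //; lra.
move=> h1 h2; rewrite -(ler_pM2l C2).
have -> : Ci ^+ 2 * (2 * dl) = dl * (2 * Ci ^+ 2) by ring.
lra.
Qed.

(** The windows [x_j - 2 dl, x_(j+1)] reach back no further than one cell, so they overlap at most
    twice and the sum is bounded by two telescoping ones. *)
Lemma sum_cell_osc W n : (n < N)%N -> (forall x y, x <= y -> W x <= W y) ->
  \sum_(j < n.+1) (W (x_ j.+1) - W (x_ j - 2 * dl)) <=
  (W (x_ n.+1) - W 0) + (W (x_ n) - W (- (2 * dl))).
Proof.
move=> nN mW; elim: n nN => [|n IH] nN; rewrite big_ord_recr /=.
  by have [-> _ _] := hm; rewrite big_ord0 add0r sub0r; lra.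
have := IH (ltnW nN); have := dl_le_cell _ (ltnW nN) => d1.
by have := mW (x_ n) (x_ n.+1 - 2 * dl); lra.
Qed.

Lemma sum_cell_osc_le B v W : slope_bv B v W ->
  \sum_(j < N) (W (x_ j.+1) - W (x_ j - 2 * dl)) <= 2 * B.
Proof.
move=> [mW WB _]; have N0 := mesh_N_gt0 _ _ hm.
have [M EN] : exists M, N = M.+1 by exists N.-1; rewrite prednK.
have MN : (M < N)%N by rewrite EN.
have := sum_cell_osc _ _ MN mW; rewrite -EN.
have [_ xN _] := hm; rewrite xN.
have := mW _ _ (mesh_le1 _ _ hm _ (ltnW MN)).
have := dl_le_h; have := mesh_size_le1 _ _ hm => h1 d1.
have H1 : W (-2) <= W (- (2 * dl)) by apply: mW; lra.
have H2 : W (-2) <= W 0 by apply: mW; lra.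
lra.
Qed.

Lemma cell_osc_bounds B v W j : (j < N)%N -> slope_bv B v W ->
  0 <= W (x_ j.+1) - W (x_ j - 2 * dl) <= B.
Proof.
move=> jN [mW WB _]; have s := mesh_step _ _ hm _ jN.
have := dl_le_h; have := mesh_size_le1 _ _ hm => h1 d1.
have d0 := dl0; have x1 := mesh_le1 _ _ hm _ jN; have x0 := mesh_ge0 _ _ hm _ (ltnW jN).
have m1 : W (x_ j - 2 * dl) <= W (x_ j.+1) by apply: mW; lra.
have m2 : W (-2) <= W (x_ j - 2 * dl) by apply: mW; lra.
by have := mW _ _ x1; lra.
Qed.

(** Source of the extra factor h^(1/2): in each squared oscillation one factor is bounded by [B],
    and the other is summed to [2 * B]. The windows extend by [2 * dl] because the two-point defect
    looks that far back. The constant is sqrt 2 rounded up to 2. *)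
Lemma nrm_cellwise B v W f (e : R) : tame 0 1 f -> slope_bv B v W -> 0 <= e ->
  (forall j, (j < N)%N -> forall y, x_ j < y < x_ j.+1 ->
     `|f y| <= e * (W (x_ j.+1) - W (x_ j - 2 * dl))) ->
  nrm f <= 2 * B * e * Num.sqrt h.
Proof.
move=> tf hW e0 fW; have N0 := mesh_N_gt0 _ _ hm.
have B0 : 0 <= B by have := cell_osc_bounds _ _ _ _ N0 hW; lra.
rewrite -ler_sqr ?nnegrE ?nrm_ge0 ?mulr_ge0 ?(ltW sh0) // nrm2.
rewrite exprMn (sqr_sqrtr (ltW h0)) ipE (integral_mesh _ _ hm _ (tameM _ _ _ _ tf tf)).
pose D j := W (x_ j.+1) - W (x_ j - 2 * dl).
apply: (@le_trans _ _ (\sum_(j < N) h * e ^+ 2 * B * D j)).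
  apply: ler_sum => -[j jN] _ /=; have s := mesh_step _ _ hm _ jN.
  have /andP[D0 DB] := cell_osc_bounds _ _ _ _ jN hW; rewrite -/(D j) in D0 DB.
  have tj := tame_cell _ _ hm _ _ jN tf.
  apply: (@le_trans _ _ ((e * D j) ^+ 2 * (x_ j.+1 - x_ j))).
    rewrite -integral_oo_cst //; apply: le_integral_oo; [exact: tameM|exact: tame_cst|].
    move=> y yj; rewrite -expr2 -[leLHS]real_normK ?num_real //.
    by rewrite lerXn2r ?nnegrE ?fW // (le_trans _ (fW _ jN _ yj)).
  have -> : (e * D j) ^+ 2 * (x_ j.+1 - x_ j) = (e ^+ 2 * D j) * ((x_ j.+1 - x_ j) * D j) by ring.
  have -> : h * e ^+ 2 * B * D j = (e ^+ 2 * D j) * (h * B) by ring.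
  apply: ler_wpM2l; first by rewrite mulr_ge0 ?sqr_ge0.
  by apply: ler_pM => //; [rewrite subr_ge0 ltW|exact: mesh_cell_le].
rewrite -mulr_sumr; apply: (@le_trans _ _ (h * e ^+ 2 * B * (2 * B))).
  by rewrite ler_wpM2l ?(sum_cell_osc_le _ _ _ hW) // !mulr_ge0 ?sqr_ge0 ?(ltW h0).
have : 0 <= h * e ^+ 2 * B * B by rewrite !mulr_ge0 ?sqr_ge0 ?(ltW h0).
by rewrite (_ : (2 * B * e) ^+ 2 * h = 4 * (h * e ^+ 2 * B * B)); [lra|ring].
Qed.

Lemma increment_close (v : R -> R) (a b s D q x z : R) : 0 <= D ->
  (forall x y, a <= x -> x <= y -> y <= b ->
    s * (y - x) <= v y - v x <= (s + D) * (y - x)) ->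
  s <= q <= s + D -> a <= x <= b -> a <= z <= b ->
  `|v z - v x - q * (z - x)| <= D * `|z - x|.
Proof.
move=> D0 hv /andP[q1 q2] /andP[ax xb] /andP[az zb].
have [xz|/ltW zx] := leP x z.
  have /andP[v1 v2] := hv x z ax xz zb; have d := xz; rewrite -subr_ge0 in d.
  have := ler_wpM2r d q1; have := ler_wpM2r d q2.
  by rewrite (ger0_norm d) ler_norml; lra.
have /andP[v1 v2] := hv z x az zx xb; have d := zx; rewrite -subr_ge0 in d.
have := ler_wpM2r d q1; have := ler_wpM2r d q2.
by rewrite (distrC z x) (ger0_norm d) ler_norml; lra.
Qed.

Lemma slope_between (v : R -> R) (a b s D x y : R) : x < y ->
  (forall x y, a <= x -> x <= y -> y <= b ->
    s * (y - x) <= v y - v x <= (s + D) * (y - x)) ->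
  a <= x -> y <= b -> s <= (v y - v x) / (y - x) <= s + D.
Proof.
move=> xy hv ax yb; have := hv x y ax (ltW xy) yb.
by rewrite ler_pdivlMr ?subr_gt0 // ler_pdivrMr ?subr_gt0.
Qed.

(** Each jump is at most the oscillation over two adjacent cells and at most [B]. Summing [B] times
    the oscillation counts every cell at most twice; with the jump at 0 this gives at most
    [3 * B ^+ 2]. *)
Lemma cell_slope_jumps B v W : periodic v 1 -> slope_bv B v W ->
  Num.sqrt (\sum_(j < N) (cell_slope x_ v j - cell_slope x_ v (prev_cell N j)) ^+ 2)
  <= 2 * B.
Proof.
move=> pv hW; have [mW WB sv] := hW; have N0 := mesh_N_gt0 _ _ hm.
have B0 : 0 <= B by have := cell_osc_bounds _ _ _ _ N0 hW; lra.
have [x0 xN _] := hm.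
(* The last cell is moved one period to the left, so that it becomes adjacent to the first. *)
have first_jump : `|cell_slope x_ v 0 - cell_slope x_ v N.-1| <= B.
  have N1 : (N.-1 < N)%N by rewrite ltn_predL.
  have s0 := mesh_step _ _ hm _ N0; have s1 := mesh_step _ _ hm _ N1.
  have x1 := mesh_le1 _ _ hm _ N0; have xm := mesh_ge0 _ _ hm _ (ltnW N1).
  rewrite (prednK N0) xN in s1; set m := x_ N.-1 in s1 xm *.
  have sx1 : 0 < x_ 1%N by rewrite -x0.
  have [|||s hs] := sv (m - 1) (x_ 1%N); try lra.
  have v1 : v 1 = v 0 by rewrite -(pv 0) add0r.
  have vm : v m = v (m - 1) by rewrite -[RHS]pv subrK.
  have Eq : cell_slope x_ v N.-1 = (v 0 - v (m - 1)) / (0 - (m - 1)).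
    by rewrite /cell_slope (prednK N0) xN v1 -/m vm; congr (_ / _); ring.
  have H1 : s <= cell_slope x_ v 0 <= s + (W (x_ 1%N) - W (m - 1)).
    by apply: slope_between hs _ _ => //; rewrite x0; lra.
  have H2 : s <= cell_slope x_ v N.-1 <= s + (W (x_ 1%N) - W (m - 1)).
    by rewrite Eq; apply: slope_between hs _ _; lra.
  have m1 := mW _ _ x1; have m2 : W (-2) <= W (m - 1) by apply: mW; lra.
  rewrite ler_norml; lra.
have jump j : (j.+1 < N)%N ->
    `|cell_slope x_ v j.+1 - cell_slope x_ v j| <= W (x_ j.+2) - W (x_ j).
  move=> jN; have s0 := mesh_step _ _ hm _ jN; have s1 := mesh_step _ _ hm _ (ltnW jN).
  have x2 := mesh_le1 _ _ hm _ jN; have xm := mesh_ge0 _ _ hm _ (ltnW (ltnW jN)).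
  have [|||s hs] := sv (x_ j) (x_ j.+2); try lra.
  have H1 : s <= cell_slope x_ v j <= s + (W (x_ j.+2) - W (x_ j)).
    by apply: slope_between hs _ _ => //; lra.
  have H2 : s <= cell_slope x_ v j.+1 <= s + (W (x_ j.+2) - W (x_ j)).
    by apply: slope_between hs _ _ => //; lra.
  rewrite ler_norml; lra.
pose J j := (cell_slope x_ v j - cell_slope x_ v (prev_cell N j)) ^+ 2.
have sumJ n : (n < N)%N ->
    \sum_(j < n.+1) J j <= B * (B + (W (x_ n.+1) - W 0) + (W (x_ n) - W 0)).
  elim: n => [|n IH] nN; rewrite big_ord_recr /=.
    rewrite big_ord0 add0r /J /prev_cell -[leLHS]real_normK ?num_real //.
    have : 0 <= W (x_ 1%N) - W 0.
      by rewrite subr_ge0 mW // (mesh_ge0 _ _ hm).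
    have := first_jump; set z := `|_|; have : 0 <= z by exact: normr_ge0.
    rewrite x0 subrr addr0 expr2 => z0 zB w0; apply: ler_pM => //; lra.
  have h1 := IH (ltnW nN); have h2 := jump _ nN.
  have D1 : W (x_ n.+2) - W (x_ n) <= B.
    have := mW _ _ (mesh_le1 _ _ hm _ nN).
    have : W (-2) <= W (x_ n) by apply: mW; have := mesh_ge0 _ _ hm _ (ltnW (ltnW nN)); lra.
    lra.
  have h3 : J n.+1 <= B * (W (x_ n.+2) - W (x_ n)).
    rewrite /J /prev_cell -[leLHS]real_normK ?num_real // expr2.
    by apply: ler_pM => //; exact: le_trans h2 D1.
  have -> : B * (B + (W (x_ n.+2) - W 0) + (W (x_ n.+1) - W 0)) =
     B * (B + (W (x_ n.+1) - W 0) + (W (x_ n) - W 0)) + B * (W (x_ n.+2) - W (x_ n)) by ring.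
  exact: lerD.
rewrite -ler_sqr ?nnegrE ?sqrtr_ge0 ?mulr_ge0 // sqr_sqrtr; last first.
  by apply: sumr_ge0 => j _; exact: sqr_ge0.
have N1 : (N.-1 < N)%N by rewrite ltn_predL.
have := sumJ _ N1; rewrite (prednK N0) xN => /le_trans; apply.
have w1 : W (x_ N.-1) <= W 1 by apply: mW; exact: (mesh_le1 _ _ hm _ (ltnW N1)).
have w0 : W (-2) <= W 0 by apply: mW; lra.
rewrite (_ : (2 * B) ^+ 2 = B * (4 * B)); last by ring.
by rewrite ler_wpM2l //; lra.
Qed.

(** [z] may lie to the left of the cell: the chord slope and all increments of [v] on the enlarged
    window share one slope interval, so the affine piece may be extended there. *)
Lemma lin_interp_close B v W j z : (j < N)%N -> slope_bv B v W ->
  x_ j - 2 * dl <= z <= x_ j.+1 -> `|z - x_ j| <= h ->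
  `|v z - (v (x_ j) + cell_slope x_ v j * (z - x_ j))| <=
    h * (W (x_ j.+1) - W (x_ j - 2 * dl)).
Proof.
move=> jN hW zj zh; have [mW WB sv] := hW; have s := mesh_step _ _ hm _ jN.
have /andP[D0 _] := cell_osc_bounds _ _ _ _ jN hW.
have d0 := dl0; have d1 := dl_le_h; have h1 := mesh_size_le1 _ _ hm.
have x1 := mesh_le1 _ _ hm _ jN; have x0 := mesh_ge0 _ _ hm _ (ltnW jN).
have [|||sl hs] := sv (x_ j - 2 * dl) (x_ j.+1); try lra.
have Hq := slope_between v _ _ _ _ _ _ s hs; rewrite -/(cell_slope x_ v j) in Hq.
have a1 : x_ j - 2 * dl <= x_ j by lra.
have a2 : x_ j - 2 * dl <= x_ j <= x_ j.+1 by rewrite a1 (ltW s).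
rewrite opprD addrA; apply: le_trans (increment_close _ _ _ _ _ _ _ _ D0 hs (Hq a1 (lexx _)) a2 zj) _.
by rewrite mulrC ler_wpM2r.
Qed.

Lemma lin_interp_error B v W : continuous v -> slope_bv B v W ->
  nrm (v - lin_interp N x_ v) <= 2 * B * h * Num.sqrt h.
Proof.
move=> cv hW; apply: (nrm_cellwise _ _ _ _ _ _ hW (ltW h0)) => //.
  apply: tameB; first exact: tame_continuous.
  exact: (tame_Vh _ _ hm _ _ (lin_interp_Vh _ _ hm k v k1)).
move=> j jN y yj; rewrite !fctE (lin_interpE _ _ hm _ j) //.
have cj := mesh_cell_le N x_ _ jN; have d0 := dl0.
apply: (lin_interp_close _ _ _ _ _ jN hW); first lra.
by rewrite ler_norml; lra.
Qed.

Lemma continuous_shift_arg v : continuous v -> continuous (fun y => v (y - dl)).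
Proof.
move=> cv y; apply: (@continuous_comp _ _ _ (fun y => y - dl) v); last exact: cv.
by apply: cvgB; [exact: cvg_id|exact: cvg_cst].
Qed.

(** On a cell, [lin_interp - dl *: slope_fun] at y is the affine piece of that cell evaluated at
    [y - dl]. *)
Lemma shift_error B v W : continuous v -> slope_bv B v W ->
  nrm ((fun y => v (y - dl)) - (lin_interp N x_ v - dl *: slope_fun N x_ v))
  <= 2 * B * h * Num.sqrt h.
Proof.
move=> cv hW; apply: (nrm_cellwise _ _ _ _ _ _ hW (ltW h0)) => //.
  apply: tameB.
    by apply: tame_continuous; exact: continuous_shift_arg.
  apply: tameB; first exact: (tame_Vh _ _ hm _ _ (lin_interp_Vh _ _ hm k v k1)).
  by apply: tameZ; exact: (tame_Vh _ _ hm _ _ (slope_fun_Vh _ _ hm k v)).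
move=> j jN y yj; rewrite !fctE (lin_interpE _ _ hm _ j) // (slope_funE _ _ hm _ j) //.
have cj := mesh_cell_le N x_ _ jN; have d0 := dl0; have d1 := dl_le_h.
rewrite (_ : _ + _ - _ = v (x_ j) + cell_slope x_ v j * (y - dl - x_ j)); last first.
  by rewrite /GRing.scale /=; ring.
apply: (lin_interp_close _ _ _ _ _ jN hW); first lra.
by rewrite ler_norml; lra.
Qed.

Lemma RKDG_step_error B v W uh w : periodic v 1 -> continuous v ->
  slope_bv B v W -> in_Vh k N x_ uh -> RKDG_step c k N x_ dt uh w ->
  nrm (w - (fun y => v (y - dl))) <= nrm (uh - lin_interp N x_ v) + 4 * B * h * Num.sqrt h.
Proof.
move=> pv cv hW Vu [Vw [v1 [v2 [V1 V2 hst]]]].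
pose I := lin_interp N x_ v; pose q := slope_fun N x_ v.
have VI : in_Vh k N x_ I by exact: lin_interp_Vh.
have Vq : in_Vh k N x_ q by exact: slope_fun_Vh.
have N0 := mesh_N_gt0 _ _ hm.
have B0 : 0 <= B by have := cell_osc_bounds _ _ _ _ N0 hW; lra.
have cS := Vh_lin_closed N x_ k.
have T := tame_Vh _ _ hm k.
have bip : bilinear_on (in_Vh k N x_) (@ip R).
  have [b1 b2] := @ip_bilinear R.
  by split=> a f f' f'' Vf Vf' Vf''; [apply: b1|apply: b2]; exact: T.
(* With [dt] absorbed, the CFL condition yields the bound with constant 1 that the energy argument
   requires. *)
pose Bf (f f' : R -> R) := dt * DG_form c N x_ f f'.
have bB : bilinear_on (in_Vh k N x_) Bf.
  have [b1 b2] := DG_bilinear _ _ hm c k.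
  by split=> a f f' f'' Vf Vf' Vf''; rewrite /Bf (b1, b2) //; ring.
have Bneg f : in_Vh k N x_ f -> Bf f f <= 0.
  by move=> Vf; rewrite /Bf pmulr_rle0 //; apply: (DG_form_le0 _ _ hm _ _ _ (ltW c0) Vf).
have Bbd f f' : in_Vh k N x_ f -> in_Vh k N x_ f' -> `|Bf f f'| <= nrm f * nrm f'.
  move=> Vf Vf'; rewrite /Bf normrM (gtr0_norm dt0).
  have := DG_form_bound _ _ hm _ _ hinv c f f' (ltW c0) Vf Vf'.
  move=> /(ler_wpM2l (ltW dt0)) /le_trans; apply.
  rewrite mulrA -[leRHS]mul1r ler_wpM2r ?mulr_ge0 ?nrm_ge0 //.
  rewrite mulrA ler_pdivrMr // mul1r; apply: le_trans cfl_dl.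
  have := dl0; have := Ci2; have := normr_ge0 Ci => n1 n2 n3.
  have -> : dt * (c * (`|Ci| + 2 * Ci ^+ 2)) = dl * (`|Ci| + 2 * Ci ^+ 2) by ring.
  by rewrite ler_wpM2l ?(ltW dl0) //; lra.
pose rho := 2 * B * h * Num.sqrt h.
have rho0 : 0 <= rho by rewrite !mulr_ge0 ?(ltW h0) ?(ltW sh0).
have := rk3_one_step_stability _ _ _ cS bip bB (fun f f' _ _ => ipC f f')
   (fun f _ => ip_ge0 f) Bneg Bbd uh v1 v2 w I q dl rho Vu V1 V2 Vw VI Vq rho0.
rewrite -/(nrm _) -/(nrm _) => /(_ _ _ _ _ _) H.
have {}H : nrm (w - (I - dl *: q)) <= nrm (uh - I) + rho.
  apply: H => f Vf.
  - by have [+ _ _] := hst f Vf.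
  - by have [_ E _] := hst f Vf; apply: etrans E _; rewrite /Bf; field.
  - by have [_ _ E] := hst f Vf; apply: etrans E _; rewrite /Bf; field.
  - by rewrite /Bf (DG_form_lin_interp _ _ hm k c v f pv Vf); ring.
  (* The defect carries [dl] twice, and both [dl] and [dl * |Ci|] are at most [h]; against the
     h^(-1/2) of the trace inequality this leaves h^(3/2). *)
  rewrite normrM (gtr0_norm dl0) /Bf normrM (gtr0_norm dt0).
  have := DG_form_slope_bound _ _ hm _ _ hinv c v f (ltW c0) Vf.
  have J := cell_slope_jumps _ _ _ pv hW.
  move=> G; have {}G : `|DG_form c N x_ q f| <= c * (`|Ci| / Num.sqrt h) * (2 * B) * nrm f.
    apply: le_trans G _; rewrite ler_wpM2r ?nrm_ge0 //.
    by rewrite ler_wpM2l // mulr_ge0 ?(ltW c0) // divr_ge0 // (ltW sh0).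
  have dd : 0 <= dl * dt by rewrite mulr_ge0 ?(ltW dl0) ?(ltW dt0).
  rewrite mulrA; apply: le_trans (ler_wpM2l dd G) _.
  rewrite (mulrA (dl * dt) _ (nrm f)) ler_wpM2r ?nrm_ge0 // /rho.
  rewrite -(ler_pM2r sh0).
  have -> : dl * dt * (c * (`|Ci| / Num.sqrt h) * (2 * B)) * Num.sqrt h =
     (2 * B) * (dl * (dl * `|Ci|)) by field; rewrite gt_eqF.
  have -> : 2 * B * h * Num.sqrt h * Num.sqrt h = (2 * B) * (h * h).
    by rewrite -{4}(sqr_sqrtr (ltW h0)); ring.
  rewrite ler_wpM2l ?mulr_ge0 // ler_pM ?(mulr_ge0 (ltW dl0)) ?(ltW dl0) ?dl_le_h //.
  apply: le_trans cfl_dl; rewrite ler_wpM2l ?(ltW dl0) //.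
  by have := Ci2; lra.
have tS : tame 0 1 ((fun y => v (y - dl)) - (I - dl *: q)).
  apply: tameB; first by apply: tame_continuous; exact: continuous_shift_arg.
  by apply: tameB; [exact: T|apply: tameZ; exact: T].
have -> : w - (fun y => v (y - dl)) = (w - (I - dl *: q)) - ((fun y => v (y - dl)) - (I - dl *: q)).
  by apply/funext => y; rewrite !fctE; ring.
apply: le_trans (nrmB _ _ _ tS) _.
  by apply: tameB; [exact: T|apply: tameB; [exact: T|apply: tameZ; exact: T]].
by have := shift_error _ _ _ cv hW; rewrite -/I -/q /rho in H *; lra.
Qed.

(** [p - I] lies in V_h, hence is an admissible test function, and orthogonality replaces [p] by
    [f]. *)
Lemma L2_projection_close f p I : tame 0 1 f -> in_Vh k N x_ I ->
  L2_projection k N x_ f p -> nrm (p - I) <= nrm (f - I).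
Proof.
move=> tf VI [Vp hp]; have T := tame_Vh _ _ hm k.
have tI := T _ VI; have tp := T _ Vp.
have VpI : in_Vh k N x_ (p - I).
  by apply: lin_closedD; [exact: Vh_lin_closed|..|apply: lin_closedN] => //; exact: Vh_lin_closed.
have tpI := tameB _ _ _ _ tp tI; have tfI := tameB _ _ _ _ tf tI.
apply: le_of_sqr_le; first exact: nrm_ge0.
rewrite nrm2 -[X in ip X _ <= _](_ : (p - f) + (f - I) = _); last by rewrite addrA subrK.
rewrite (bilinD_l _ _ ip_bilinear) //; last exact: tameB.
rewrite [X in X + _](hp _ VpI) add0r.
exact: le_trans (ler_norm _) (cauchy_schwarz _ _ tfI tpI).
Qed.

End OneStep.

(** * Error accumulation *)

Section SchemeError.
Context {R : realType}.
Implicit Types (f v w W : R -> R).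

Lemma max_contraction (a b d : R) : `|Num.max a d - Num.max b d| <= `|a - b|.
Proof.
rewrite ler_norml; have := ler_norm (a - b); have := ler_norm (- (a - b)); rewrite normrN.
by case: (leP a d); case: (leP b d); lra.
Qed.

Lemma nrm_le_bound f (M : R) : tame 0 1 f -> 0 <= M ->
  (forall x, 0 < x < 1 -> `|f x| <= M) -> nrm f <= M.
Proof.
move=> tf M0 fM; have tM := tame_cst 0 1 M.
apply: le_trans (le_nrm _ _ tf tM _) _.
  by move=> x /fM h; rewrite /= (ger0_norm M0).
rewrite /nrm ipE (eq_integral_oo _ _ _ (cst (M * M))) // integral_oo_cst //.
by rewrite subr0 mulr1 -expr2 sqrtr_sqr ger0_norm.
Qed.

(** The two-point defect involves the variations at two successive times; their sum is again an
    admissible variation function, so [nrm_cellwise] applies once. *)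
Lemma slope_bvD (B1 B2 : R) v w W1 W2 : slope_bv B1 v W1 -> slope_bv B2 w W2 ->
  slope_bv (B1 + B2) v (W1 + W2).
Proof.
move=> [m1 b1 s1] [m2 b2 _]; split=> [x y xy||a b a2 ab bb]; rewrite !fctE.
- by rewrite lerD ?m1 ?m2.
- lra.
have [s hs] := s1 a b a2 ab bb; exists s => x y ax xy yb.
have /andP[-> h2] := hs x y ax xy yb; rewrite (le_trans h2) //.
by rewrite ler_wpM2r ?subr_ge0 //; have := m2 a b (ltW ab); lra.
Qed.

Lemma two_point_max_defect_cell c (g : R -> R) (K dt h : R) v w Bv Bw Wv Ww (a b y : R) :
  0 < c -> (forall x y, `|g x - g y| <= K * `|x - y|) -> 0 < dt ->
  c * dt <= h -> h <= 1 -> slope_bv Bv v Wv -> slope_bv Bw w Ww ->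
  (forall z, g z <= v z) ->
  (forall z, w z = Num.max (v (z - c * dt)) (running_max c g dt z)) ->
  0 <= a <= y -> y <= b -> b <= 1 ->
  `|Num.max (v (y - c * dt)) (two_point_max c g dt y) -
    Num.max (v (y - c * dt)) (running_max c g dt y)| <=
  h * ((Wv + Ww) b - (Wv + Ww) (a - 2 * (c * dt))).
Proof.
move=> c0 gK dt0 dlh h1 hW hW' gv wE /andP[a0 ay] yb b1.
have rt := two_point_max_le _ _ _ c0 gK dt y (ltW dt0).
have dl0 : 0 < c * dt by rewrite mulr_gt0.
have a2 : -2 <= y - 2 * (c * dt) by lra.
have y1 : y <= 1 by lra.
have := two_point_max_defect _ _ _ c0 gK dt v w Wv Ww Bv Bw y dt0 hW hW' gv wE a2 y1.
set Dl := _ + (_ - _) => H.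
have [mW _ _] := hW; have [mW' _ _] := hW'.
have yy : y - 2 * (c * dt) <= y by lra.
have Dl0 : 0 <= Dl by apply: addr_ge0; rewrite subr_ge0; [exact: mW|exact: mW'].
have xy : a - 2 * (c * dt) <= y - 2 * (c * dt) by lra.
have DlW : Dl <= (Wv + Ww) b - (Wv + Ww) (a - 2 * (c * dt)).
  rewrite !fctE /Dl.
  by have := mW _ _ yb; have := mW' _ _ yb; have := mW _ _ xy; have := mW' _ _ xy; clear; lra.
have dDl : c * dt * Dl <= h * ((Wv + Ww) b - (Wv + Ww) (a - 2 * (c * dt))).
  by apply: ler_pM => //; exact: ltW.
have cDl : 0 <= c * dt * Dl by rewrite mulr_ge0 // ltW.
apply: le_trans dDl.
have le1 : Num.max (v (y - c * dt)) (running_max c g dt y) <=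
    Num.max (v (y - c * dt)) (two_point_max c g dt y) + c * dt * Dl.
  rewrite ge_max H andbT; set m2 := Num.max _ _.
  by rewrite -[leLHS]addr0 lerD // le_max lexx.
have le2 : Num.max (v (y - c * dt)) (two_point_max c g dt y) <=
    Num.max (v (y - c * dt)) (running_max c g dt y) by rewrite le_max2.
by rewrite ler_norml; move: le1 le2 cDl; clear; lra.
Qed.

(** The maximum of the shifted [v] and [gt] is inserted between [uh'] and [v']. The 6 is 4 from the
    Runge-Kutta step and 2 from interpolating [v']; [eta] is the consistency error of the
    obstacle. *)
Lemma scheme_step c k N (x_ : nat -> R) Ci dt B v v' W W' gt uh w uh' (eta : R) :
  0 < c -> (1 <= k)%N -> is_mesh N x_ -> inverse_inequalities k N x_ Ci ->
  0 < dt -> dt <= (c * (1 + `|Ci| + 2 * Ci ^+ 2))^-1 * mesh_size N x_ ->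
  periodic v 1 -> continuous v -> slope_bv B v W ->
  continuous v' -> slope_bv B v' W' -> tame 0 1 gt ->
  in_Vh k N x_ uh -> RKDG_step c k N x_ dt uh w ->
  L2_projection k N x_ (fun y => Num.max (w y) (gt y)) uh' ->
  nrm ((fun y => Num.max (v (y - c * dt)) (gt y)) - v') <= eta ->
  nrm (uh' - lin_interp N x_ v') <= nrm (uh - lin_interp N x_ v) +
    6 * B * mesh_size N x_ * Num.sqrt (mesh_size N x_) + eta.
Proof.
move=> c0 k1 hm hinv dt0 cfl pv cv hW cv' hW' tg Vu hw hp heta.
have [Vw _] := hw; have T := tame_Vh _ _ hm k; have tw := T _ Vw.
have VI := lin_interp_Vh _ _ hm k v' k1; have tI := T _ VI.
have tv' := tame_continuous 0 1 _ cv'.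
have tsv := tame_continuous 0 1 _ (continuous_shift_arg c dt v cv).
have tm := tame_max _ _ _ _ tw tg; have tsm := tame_max _ _ _ _ tsv tg.
have h1 := L2_projection_close k N x_ hm _ _ _ tm VI hp.
have h2 := RKDG_step_error c k N x_ Ci dt c0 k1 hm hinv dt0 cfl _ _ _ uh w pv cv hW Vu hw.
have h3 := lin_interp_error c k N x_ Ci dt c0 k1 hm hinv dt0 cfl _ _ _ cv' hW'.
set mw := fun y => Num.max (w y) (gt y) in h1 tm.
set ms := fun y => Num.max (v (y - c * dt)) (gt y) in heta tsm.
have h4 : nrm (mw - ms) <= nrm (w - (fun y => v (y - c * dt))).
  apply: le_nrm; [exact: tameB|exact: tameB|move=> y _; exact: max_contraction].
have E : mw - lin_interp N x_ v' = (mw - ms) + ((ms - v') + (v' - lin_interp N x_ v')).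
  by rewrite [ms - v' + _]addrA !subrK addrA subrK.
have := nrmD _ _ (tameB _ _ _ _ tm tsm) (tameD _ _ _ _ (tameB _ _ _ _ tsm tv') (tameB _ _ _ _ tv' tI)).
rewrite -E; have := nrmD _ _ (tameB _ _ _ _ tsm tv') (tameB _ _ _ _ tv' tI).
by move: h1 h2 h3 h4 heta; clear; lra.
Qed.

Lemma exact_sol0 c (u0 g : R -> R) : exact_sol c u0 g 0 = u0.
Proof. by apply/funext => x; rewrite /exact_sol eqxx. Qed.

(** Per step, 10 = 6 + 4, the 4 being the two-point defect; the 2 is the initial projection. The
    term [K * (c * dt)] is paid in the first step and never again. *)
Lemma scheme_error c k N (x_ : nat -> R) Ci dt B (K T : R) (u0 g : R -> R)
    (gtilde : R -> R -> R) uh :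
  0 < c -> (1 <= k)%N -> is_mesh N x_ -> inverse_inequalities k N x_ Ci ->
  0 < dt -> dt <= (c * (1 + `|Ci| + 2 * Ci ^+ 2))^-1 * mesh_size N x_ ->
  (forall x y, `|g x - g y| <= K * `|x - y|) ->
  (forall t, 0 <= t <= T -> [/\ periodic (exact_sol c u0 g t) 1,
     continuous (exact_sol c u0 g t) &
     exists W, slope_bv B (exact_sol c u0 g t) W]) ->
  gtilde = running_max c g \/ gtilde = two_point_max c g ->
  obstacle_scheme c k N x_ dt u0 (gtilde dt) uh ->
  forall n : nat, n%:R * dt <= T ->
  in_Vh k N x_ (uh n) /\
  nrm (uh n - lin_interp N x_ (exact_sol c u0 g (n%:R * dt))) <=
    (10 * n%:R + 2) * B * mesh_size N x_ * Num.sqrt (mesh_size N x_) +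
    (0 < n)%:R * (K * (c * dt)).
Proof.
move=> c0 k1 hm hinv dt0 cfl gK hu hg [hp0 hstep].
set h := mesh_size N x_ in cfl *.
have hgt : 0 < h := mesh_size_gt0 _ _ hm; have h1 : h <= 1 := mesh_size_le1 _ _ hm.
have dl0 : 0 < c * dt by rewrite mulr_gt0.
have dlh : c * dt <= h := dl_le_h c N x_ Ci dt c0 dt0 cfl.
have N0 := mesh_N_gt0 _ _ hm.
have K0 : 0 <= K by have := gK 0 1; rewrite sub0r normrN1 mulr1; exact: le_trans.
have cg := lipschitz_continuous _ _ gK.
have tgt : tame 0 1 (gtilde dt).
  case: hg => ->.
    apply: tame_continuous; apply: lipschitz_continuous => x y.
    exact: (running_max_lipschitz _ _ _ c0 gK _ _ _ (ltW dt0)).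
  apply: tame_max; apply: tame_continuous => //; exact: continuous_shift_arg.
elim=> [|n IH] nT.
  have [|pu cu [W hW]] := hu 0; first by rewrite lexx /=; move: nT; rewrite mul0r.
  rewrite mul0r /= mul0r addr0 mulr0 add0r; split; first by case: hp0.
  have e0 := lin_interp_error c k N x_ Ci dt c0 k1 hm hinv dt0 cfl _ _ _ cu hW.
  rewrite exact_sol0 in cu e0 *; apply: le_trans e0.
  apply: (L2_projection_close k N x_ hm) => //; first exact: tame_continuous.
  exact: lin_interp_Vh.
have nT' : n%:R * dt <= T by move: nT; rewrite -natr1 mulrDl mul1r; lra.
have [Vu En] := IH nT'.
have t0 : 0 <= n%:R * dt by rewrite mulr_ge0 // ltW.
have tE : n.+1%:R * dt = n%:R * dt + dt by rewrite -natr1 mulrDl mul1r.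
have [|pv cv [W hW]] := hu (n%:R * dt); first by rewrite t0.
have [|_ cv' [W' hW']] := hu (n.+1%:R * dt); first by rewrite nT mulr_ge0 // ltW.
set v := exact_sol c u0 g (n%:R * dt) in pv cv hW En *.
set v' := exact_sol c u0 g (n.+1%:R * dt) in cv' hW' *.
have v'E y : v' y = Num.max (v (y - c * dt)) (running_max c g dt y).
  by rewrite /v' tE (exact_solD _ _ _ _ c0 gK).
have [w hw hp] := hstep n.
split; first by case: hp.
have B0 : 0 <= B.
  by have := cell_osc_bounds c N x_ Ci dt c0 hm dt0 cfl _ _ _ _ N0 hW; lra.
have BH : 0 <= B * h * Num.sqrt h by rewrite !mulr_ge0 ?sqrtr_ge0 // ltW.
(* For [n = 0] the inequality [g <= v] may fail, and only the Lipschitz bound on [g] is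
   available. *)
pose e := 4 * B * h * Num.sqrt h + (n == 0)%:R * (K * (c * dt)).
have Kd : 0 <= K * (c * dt) by rewrite mulr_ge0 // ltW.
have e0 : 0 <= e by rewrite addr_ge0 ?mulr_ge0 ?sqrtr_ge0 ?ler0n // ltW.
pose D := (fun y => Num.max (v (y - c * dt)) (gtilde dt y)) - v'.
have tD : tame 0 1 D.
  apply: tameB; last exact: tame_continuous.
  by apply: tame_max => //; apply: tame_continuous; exact: continuous_shift_arg.
have De : nrm D <= e.
  case: hg => gE.
    rewrite (_ : D = cst 0); last first.
      by apply/funext => y; rewrite /D !fctE gE v'E subrr.
    by apply: nrm_le_bound => //; [exact: tame_cst|move=> y _; rewrite normr0].
  have rt y : two_point_max c g dt y <= running_max c g dt y.
    exact: (two_point_max_le _ _ _ c0 gK _ _ (ltW dt0)).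
  have [n0|n0] := eqVneq n 0%N.
    apply: (@le_trans _ _ (K * (c * dt))).
      apply: nrm_le_bound => // y _; rewrite /D !fctE gE v'E.
      rewrite !(maxC (v _)); apply: le_trans (max_contraction _ _ _) _.
      have := two_point_max_close _ _ _ c0 gK dt y (ltW dt0); have := rt y.
      by rewrite ler_norml; lra.
    by rewrite /e n0 mul1r lerDr; lra.
  have n1 : (0 < n)%N by rewrite lt0n.
  have tp : 0 < n%:R * dt by rewrite mulr_gt0 // ltr0n.
  have gv z : g z <= v z by exact: (exact_sol_ge _ _ _ _ c0 gK).
  have hWW := slope_bvD _ _ _ _ _ _ hW hW'.
  have := nrm_cellwise c k N x_ Ci dt c0 hm hinv dt0 cfl _ _ _ _ _ tD hWW (ltW hgt) _.
  rewrite /e -/h (negbTE n0) mul0r addr0 (_ : 2 * (B + B) = 4 * B); last by ring.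
  apply => j jN y /andP[y1 y2].
  have s := mesh_step _ _ hm _ jN.
  have x1 := mesh_le1 _ _ hm _ jN; have x0 := mesh_ge0 _ _ hm _ (ltnW jN).
  rewrite /D !fctE gE v'E.
  apply: (two_point_max_defect_cell _ _ _ _ _ _ _ B B _ _ _ _ _ c0 gK dt0 dlh h1 hW hW') => //.
  - by rewrite x0 (ltW y1).
  - exact: ltW.
have := scheme_step c k N x_ Ci dt B v v' W W' (gtilde dt) (uh n) w (uh n.+1) e
  c0 k1 hm hinv dt0 cfl pv cv hW cv' hW' tgt Vu hw hp De.
rewrite -/h => /le_trans; apply; rewrite /e.
have -> : (0 < n.+1)%N%:R = 1 :> R by [].
have : (0 < n)%N%:R * (K * (c * dt)) + (n == 0)%:R * (K * (c * dt)) = K * (c * dt).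
  by case: (n) => [|m] /=; rewrite mul0r mul1r ?addr0 ?add0r.
by rewrite -natr1; move: En BH Kd; rewrite -/h; clear; lra.
Qed.

End SchemeError.

Theorem theorem5p2 (R : realType) (c : R) (k : nat) (Cinv : R)
    (c_gt0 : 0 < c) (k_ge1 : (1 <= k)%N) :
  exists2 C0 : R, 0 < C0 &
  forall (T : R) (l p : nat) (L c0 : R) (u0 g : R -> R)
    (gtilde : R -> R -> R),
  0 < T -> (2 <= l)%N ->
  periodic u0 1 -> [lipschitz u0 x | x in setT] ->
  periodic g 1 -> [lipschitz g x | x in setT] ->
  (forall t : R, 0 <= t <= T ->
     piecewise_class l.+1 p L c0 (exact_sol c u0 g t)) ->
  gtilde = running_max c g \/ gtilde = two_point_max c g ->
  (exists2 C : R, 0 <= C &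
   forall (N : nat) (x_ : nat -> R) (dt : R) (uh : nat -> R -> R),
   is_mesh N x_ -> inverse_inequalities k N x_ Cinv ->
   0 < dt -> dt <= C0 * mesh_size N x_ ->
   obstacle_scheme c k N x_ dt u0 (gtilde dt) uh ->
   forall n : nat, n%:R * dt <= T ->
   (normL2 (fun y => uh n y - exact_sol c u0 g (n%:R * dt) y)%R
    <= (C * Num.sqrt (mesh_size N x_ + mesh_size N x_ ^+ 3 / dt ^+ 2))%:E)%E)
  /\
  (forall Cbar0 : R, 0 < Cbar0 ->
   exists C1 : R,
   forall (N : nat) (x_ : nat -> R) (dt : R) (uh : nat -> R -> R),
   is_mesh N x_ -> inverse_inequalities k N x_ Cinv ->
   0 < dt -> dt <= C0 * mesh_size N x_ ->
   Cbar0 <= dt / mesh_size N x_ ->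
   obstacle_scheme c k N x_ dt u0 (gtilde dt) uh ->
   forall n : nat, n%:R * dt <= T ->
   (normL2 (fun y => uh n y - exact_sol c u0 g (n%:R * dt) y)%R
    <= (C1 * Num.sqrt (mesh_size N x_))%:E)%E).
Proof.
pose P := c * (1 + `|Cinv| + 2 * Cinv ^+ 2).
have P0 : 0 < P.
  by rewrite mulr_gt0 //; have := normr_ge0 Cinv; have := sqr_ge0 Cinv; lra.
exists P^-1; first by rewrite invr_gt0.
move=> T l p L c0 u0 g gtilde T0 l2 _ _ _ lg hcl hg.
have [K K0 gK] := lipschitz_bound _ lg.
have [B B0 hB] := piecewise_class_slope_bv l.+1 p L c0 l2.
have hu t : 0 <= t <= T -> [/\ periodic (exact_sol c u0 g t) 1,
     continuous (exact_sol c u0 g t) & exists W, slope_bv B (exact_sol c u0 g t) W].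
  move=> /hcl hv; have [pv lv _ _ _] := hv; split => //; last exact: hB.
  by have [Kv _ hKv] := lipschitz_bound _ lv; exact: lipschitz_continuous hKv.
(* [10 * T * B] comes from n <= T / dt steps, [4 * B] from interpolating the initial and the final
   state, and [K] from the first step, where [c * dt <= h <= sqrt h]. *)
pose C := 10 * T * B + 4 * B + K.
have C_ge0 : 0 <= C by rewrite !addr_ge0 ?mulr_ge0 // ltW.
have main (N : nat) (x_ : nat -> R) (dt : R) (uh : nat -> R -> R) :
   is_mesh N x_ -> inverse_inequalities k N x_ Cinv ->
   0 < dt -> dt <= P^-1 * mesh_size N x_ ->
   obstacle_scheme c k N x_ dt u0 (gtilde dt) uh ->
   forall n : nat, n%:R * dt <= T ->
   (normL2 (fun y => uh n y - exact_sol c u0 g (n%:R * dt) y)%R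
    <= (C * Num.sqrt (mesh_size N x_ + mesh_size N x_ ^+ 3 / dt ^+ 2))%:E)%E.
  move=> hm hinv dt0 cfl hs n nT.
  have [Vu En] := scheme_error c k N x_ Cinv dt B K T u0 g gtilde uh
    c_gt0 k_ge1 hm hinv dt0 cfl gK hu hg hs n nT.
  have [|_ cv [W hW]] := hu (n%:R * dt); first by rewrite nT mulr_ge0 // ltW.
  have e0 := lin_interp_error c k N x_ Cinv dt c_gt0 k_ge1 hm hinv dt0 cfl _ _ _ cv hW.
  have dlh := dl_le_h c N x_ Cinv dt c_gt0 dt0 cfl.
  have h0 := mesh_size_gt0 _ _ hm; have h1 := mesh_size_le1 _ _ hm.
  set h := mesh_size N x_ in En e0 h0 h1 dlh *.
  set v := exact_sol c u0 g (n%:R * dt) in En cv hW e0 *.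
  have T1 := tame_Vh _ _ hm k; have tu := T1 _ Vu.
  have tI := T1 _ (lin_interp_Vh _ _ hm k v k_ge1).
  have tv := tame_continuous 0 1 _ cv.
  have -> : (fun y => uh n y - v y) = uh n - v by [].
  rewrite normL2E; last exact: tameB.
  rewrite lee_fin; set I := lin_interp N x_ v in En e0 tI.
  have : nrm (uh n - v) <= nrm (uh n - I) + nrm (v - I).
    have -> : uh n - v = (uh n - I) - (v - I) by rewrite opprB addrA subrK.
    by apply: nrmB; exact: tameB.
  set S := Num.sqrt (h + _).
  have sh0 : 0 <= Num.sqrt h by exact: sqrtr_ge0.
  have q0 : 0 <= h ^+ 3 / dt ^+ 2 by rewrite divr_ge0 ?exprn_ge0 // ltW.
  have shS : Num.sqrt h <= S by rewrite ler_sqrt ?addr_ge0 ?(ltW h0) // lerDl.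
  have hsh : h <= Num.sqrt h.
    rewrite -{1}(sqr_sqrtr (ltW h0)) expr2 -[leRHS]mulr1 ler_wpM2l //.
    by rewrite -[leRHS]sqrtr1 ler_sqrt.
  have hhS : h * Num.sqrt h / dt <= S.
    have p0 : 0 <= h * Num.sqrt h / dt by rewrite divr_ge0 ?mulr_ge0 // ltW.
    rewrite -[leLHS]ger0_norm // -sqrtr_sqr ler_sqrt ?addr_ge0 ?(ltW h0) //.
    rewrite !exprMn exprVn sqr_sqrtr ?(ltW h0) // -exprSr.
    by rewrite lerDr ltW.
  have hh : h * Num.sqrt h <= S.
    by apply: le_trans shS; rewrite ler_piMl.
  have nS : n%:R * (h * Num.sqrt h) <= T * S.
    have -> : n%:R * (h * Num.sqrt h) = n%:R * dt * (h * Num.sqrt h / dt).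
      by field; rewrite gt_eqF.
    apply: ler_pM => //; first by rewrite mulr_ge0 // ltW.
    by rewrite divr_ge0 ?mulr_ge0 // ltW.
  have KS : (0 < n)%N%:R * (K * (c * dt)) <= K * S.
    apply: (@le_trans _ _ (K * (c * dt))).
      rewrite -[leRHS]mul1r ler_wpM2r ?mulr_ge0 // ?(ltW c_gt0) ?(ltW dt0) //.
      by case: (n) => [|m] /=; rewrite ?ler01.
    by rewrite ler_wpM2l // (le_trans dlh) // (le_trans hsh).
  have := ler_wpM2l B0 nS; have := ler_wpM2l B0 hh.
  by rewrite /C; move: En e0 KS; clear; lra.
split; first by exists C.
(* [Cb * h <= dt] gives h^3 / dt^2 <= h / Cb^2. *)
move=> Cb Cb0; exists (C * Num.sqrt (1 + (Cb ^+ 2)^-1)).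
move=> N x_ dt uh hm hinv dt0 cfl low hs n nT.
apply: le_trans (main N x_ dt uh hm hinv dt0 cfl hs n nT) _.
have h0 := mesh_size_gt0 _ _ hm; set h := mesh_size N x_ in low h0 *.
rewrite lee_fin -mulrA ler_wpM2l // -sqrtrM; last by rewrite addr_ge0 // invr_ge0 sqr_ge0.
have Cb2 : 0 < Cb ^+ 2 by rewrite exprn_gt0.
rewrite ler_sqrt; last by rewrite mulr_ge0 ?(ltW h0) // addr_ge0 // invr_ge0 ltW.
rewrite mulrDl mul1r lerD2l ler_pdivrMr ?exprn_gt0 //.
move: low; rewrite ler_pdivlMr // => low.
have : (Cb * h) ^+ 2 <= dt ^+ 2 by rewrite lerXn2r ?nnegrE ?mulr_ge0 // ltW.
rewrite exprMn => low2.
have -> : (Cb ^+ 2)^-1 * h * dt ^+ 2 = h / Cb ^+ 2 * dt ^+ 2 by ring.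
apply: le_trans (_ : h / Cb ^+ 2 * (Cb ^+ 2 * h ^+ 2) <= _); last first.
  by rewrite ler_wpM2l // divr_ge0 // ltW.
by rewrite mulrA divfK ?gt_eqF // -exprS.
Qed.
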